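(* Suppose that the reference action sequence $\{\mathring{\boldsymbol a}_{n,m}(t)\in\triangle(\mathcal N)\}_{(n,m)\in\mathcal L,t\in[T]}$ satisfies the multi-hop piecewise stability assumption (see context), and that its path length satisfies $$P_t^a:=\sum_{s=1}^{t-1}\sum_{(n,m)\in\mathcal L}\|\mathring{\boldsymbol a}_{n,m}(s)-\mathring{\boldsymbol a}_{n,m}(s+1)\|_1\le C^at^{1/2-\delta_a},\qquad\forall t=1,2,\dots,T,$$ where $C^a$ and $\delta_a$ are assumed to be known constants but the precise $P_t^a$ and $\{\mathring{\boldsymbol a}_{n,m}(t)\}_{(n,m)\in\mathcal L,t\in[T]}$ both remain unknown. Then, if the algorithm NSO is executed with the sub-routine AdaPFOL (see context), $$\frac1T\,\mathbb E\Big[\sum_{t=1}^T\|\boldsymbol Q(t)\|_1\Big]=\mathcal O\!\left(\frac{(N^2(2NM+R)^2+\epsilon_WN^2(2NM+R))C_W+(N^4M^2+N^2R^2)}{\epsilon_W}\right)+o_T(1).$$ That is, when $T\gg0$, $\frac1T\mathbb E[\sum_{t=1}^T\|\boldsymbol Q(t)\|_1]=\mathcal O_T(1)$, i.e. the system is stable.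
   Context: **Asymptotic notation.** $\mathcal O$ hides absolute constants. $f(T)=\mathcal O_T(g(T))$ means $\limsup_{T\to\infty}f(T)/g(T)<\infty$ and $f(T)=o_T(g(T))$ means $\limsup_{T\to\infty}f(T)/g(T)=0$. Norms of matrices are taken entrywise. **Network model.** $\mathcal N$ is a finite set of servers, $N=|\mathcal N|$; $\mathcal L\subseteq\mathcal N\times\mathcal N$ is a finite set of directed data links, which do not interfere with each other; $[T]=\{1,\dots,T\}$ is the set of rounds. $\triangle(\mathcal N)$ is the set of probability distributions over $\mathcal N$. Commodities are indexed by $\mathcal N$; commodity-$k$ jobs are destined for server $k$. $Q_n^{(k)}(t)$ is the number of unfinished commodity-$k$ jobs queued at server $n$ at the beginning of round $t$, $\boldsymbol Q_n(t)=(Q_n^{(k)}(t))_{k\in\mathcal N}$, $\boldsymbol Q(t)=(Q_n^{(k)}(t))_{n,k}$, and $\boldsymbol Q(1)=\boldsymbol0$. In round $t$ the scheduler, with no information about the current round, chooses for each link $(n,m)\in\mathcal L$ a distribution $\boldsymbol a_{n,m}(t)\in\triangle(\mathcal N)$ over commodities. Link $(n,m)$ has a time-varying capacity $C_{n,m}(t)\in[0,M]$. The numbers $\mu_{n,m}^{(k)}(t)\in[0,M]$ of commodity-$k$ jobs sent over $(n,m)$ are independently generated with $\mathbb E[\mu_{n,m}^{(k)}(t)]=C_{n,m}(t)a_{n,m}^{(k)}(t)$. The arrival rates $\boldsymbol\lambda(t)=(\lambda_n^{(k)}(t))\in[0,R]^{N\times N}$ are arbitrary, unknown and time-varying, chosen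 by an oblivious adversary. Capacities, transmissions and arrival rates are revealed only after the decision of round $t$. With $[x]_+=\max\{x,0\}$, the dynamics are $$Q_n^{(k)}(t+1)=\Big[Q_n^{(k)}(t)-\sum_{m:(n,m)\in\mathcal L}\mu_{n,m}^{(k)}(t)\Big]_++\sum_{o:(o,n)\in\mathcal L}\mu_{o,n}^{(k)}(t)+\lambda_n^{(k)}(t)\quad(k\neq n),\qquad Q_n^{(n)}(t+1)=0.$$ **Multi-hop piecewise stability assumption.** There is a reference action sequence $\{\mathring{\boldsymbol a}(t)\}_{t\in[T]}$, $\mathring{\boldsymbol a}(t)=\{\mathring{\boldsymbol a}_{n,m}(t)\in\triangle(\mathcal N)\}_{(n,m)\in\mathcal L}$, such that there are constants $C_W\ge0$, $\epsilon_W\ge0$ and a partition of $[T]$ into disjoint intervals $W_1,\dots,W_J$ with $\sum_{j=1}^J(|W_j|-1)^2\le C_WT$ and, for all $j\in[J]$, $n\in\mathcal N$, $k\in\mathcal N$, $$\frac1{|W_j|}\sum_{t\in W_j}\sum_{m:(n,m)\in\mathcal L}C_{n,m}(t)\mathring a_{n,m}^{(k)}(t)\ge\epsilon_W+\frac1{|W_j|}\sum_{t\in W_j}\Big(\lambda_n^{(k)}(t)+\sum_{o:(o,n)\in\mathcal L}C_{o,n}(t)\mathring a_{o,n}^{(k)}(t)\Big).$$ **Sub-routine AdaPFOL (online linear optimization).** In online linear optimization over a convex set $\mathcal X\subseteq\mathbb R^d$, in each round the player picks $\boldsymbol x_t\in\mathcal X$, the environment simultaneously picks $\boldsymbol g_t\in\mathbb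 R^d$, the loss is $\langle\boldsymbol x_t,\boldsymbol g_t\rangle$, and the whole $\boldsymbol g_t$ is then revealed. Let PFOL (Cutkosky 2020, Theorem 6; used as a black box) be an algorithm which, when $\mathcal X$ has diameter $D=\sup_{\boldsymbol x,\boldsymbol y\in\mathcal X}\|\boldsymbol x-\boldsymbol y\|_1$ and all $\|\boldsymbol g_t\|_\infty\le1$, guarantees for every comparator sequence $\mathring{\boldsymbol x}_1,\dots,\mathring{\boldsymbol x}_T\in\mathcal X$ that $$\sum_{t=1}^T\langle\boldsymbol g_t,\boldsymbol x_t-\mathring{\boldsymbol x}_t\rangle=\mathcal O\Big(\sqrt{D\big(D+\textstyle\sum_{t=1}^{T-1}\|\mathring{\boldsymbol x}_t-\mathring{\boldsymbol x}_{t+1}\|_1\big)}\sqrt{1+\textstyle\sum_{t=1}^T\|\boldsymbol g_t\|_\infty^2}\,\log\big(T\textstyle\sum_{t=1}^T\|\boldsymbol g_t\|_\infty^2\big)\Big).$$ AdaPFOL on $\mathcal X$: set $\bar G\leftarrow1$ and start an instance $\mathcal A$ of PFOL on $\mathcal X$. In each round $t$: receive a bound $G_t>0$ with $\|\boldsymbol g_t\|_\infty\le G_t$; if $G_t>\bar G$, set $\bar G\leftarrow2G_t$ and reset $\mathcal A$ to a fresh instance of PFOL on $\mathcal X$; output the output of $\mathcal A$; observe $\boldsymbol g_t$; feed $\bar G^{-1}\boldsymbol g_t$ to $\mathcal A$. **Algorithm NSO.** For each link $(n,m)\in\mathcal L$ run a separate instance of AdaPFOL on $\mathcal X=\triangle(\mathcal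 N)$ with magnitude bound $G_t=M\|\boldsymbol Q_m(t)-\boldsymbol Q_n(t)\|_\infty$ and loss vector $\boldsymbol g_t=C_{n,m}(t)(\boldsymbol Q_m(t)-\boldsymbol Q_n(t))$; its output in round $t$ is used as $\boldsymbol a_{n,m}(t)$.
   Formalization: The formal theorem assumes ε_W > 0 and δ_a > 0 (the bound divides by ε_W; for δ_a ≤ 0 the o_T(1) claim can fail), requires the stability inequality only for k ≠ n (with k = n it is contradictory), and reads the logarithm in the PFOL bound as max(1, log). *)

(* Defs.v *)
From HB Require Import structures.
From mathcomp Require Import all_boot all_order all_algebra.
From mathcomp Require Import all_classical all_reals all_analysis.

Set Implicit Arguments.
Unset Strict Implicit.
Unset Printing Implicit Defensive.

Import Order.TTheory GRing.Theory Num.Theory.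
Import numFieldNormedType.Exports.

Local Open Scope classical_set_scope.
Local Open Scope ring_scope.

(* Rounds are the natural numbers 1, ..., T; the values of time-indexed families
   at other indices are never constrained. *)

Section Vectors.
Context {R : realType} {I : finType}.
Implicit Types x y : I -> R.

Definition norm1 x : R := \sum_i `|x i|.

Definition normoo x : R := \big[Num.max/0]_i `|x i|.

Definition inner x y : R := \sum_i x i * y i.

Definition simplex : set (I -> R) :=
  [set x | (forall i, 0 <= x i) /\ \sum_i x i = 1].

Definition diameter1 (X : set (I -> R)) : R :=
  sup [set r | exists x y, [/\ X x, X y & r = norm1 (x \- y)]].

End Vectors.
Arguments simplex R I : clear implicits.

Section OnlineLinearOptimization.
Context {R : realType} {I : finType}.
Local Notation vec := (I -> R).

(* An algorithm maps the list of past loss vectors, oldest first, to its next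
   play. *)
Definition olo_alg := seq vec -> vec.

Definition olo_play (A : olo_alg) (g : nat -> vec) (t : nat) : vec :=
  A [seq g s | s <- index_iota 1 t].

(* The dynamic regret bound, with the constant hidden in O made explicit as K0.
   The logarithm is truncated below at 1: for T * \sum_t |g_t|^2 < 1 it would be
   negative, and no algorithm has negative regret against its own plays. *)
Definition PFOL_guarantee (X : set vec) (K0 : R) (A : olo_alg) : Prop :=
  (forall h, X (A h)) /\
  forall (T : nat) (g u : nat -> vec),
    (forall t, (1 <= t <= T)%N -> normoo (g t) <= 1) ->
    (forall t, (1 <= t <= T)%N -> X (u t)) ->
    let D := diameter1 X in
    let path := \sum_(1 <= t < T) norm1 (u t \- u t.+1) in
    let V := \sum_(1 <= t < T.+1) normoo (g t) ^+ 2 in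
    \sum_(1 <= t < T.+1) inner (g t) (olo_play A g t \- u t) <=
      K0 * (Num.sqrt (D * (D + path)) * Num.sqrt (1 + V) *
            Num.max 1 (ln (T%:R * V))).

(* The current value of \bar G and the losses fed so far to the current instance
   of PFOL, oldest first. *)
Definition adapfol_state : Type := R * seq vec.

Definition adapfol_receive (G : R) (st : adapfol_state) : adapfol_state :=
  if st.1 < G then (2 * G, [::]) else st.

Definition adapfol_feed (g : vec) (st : adapfol_state) : adapfol_state :=
  (st.1, rcons st.2 (fun i => st.1^-1 * g i)).

(* The state at the beginning of round t, before G_t is received. *)
Fixpoint adapfol_before (G : nat -> R) (g : nat -> vec) (t : nat) :
    adapfol_state :=
  if t is (_.+1 as s).+1 then
    adapfol_feed (g s) (adapfol_receive (G s) (adapfol_before G g s))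
  else (1, [::]).

Definition adapfol (A : olo_alg) (G : nat -> R) (g : nat -> vec) (t : nat) :
    vec :=
  A (adapfol_receive (G t) (adapfol_before G g t)).2.

End OnlineLinearOptimization.
Arguments olo_alg R I : clear implicits.

Section Network.
Context {R : realType} {S : finType}.
Variable L : {set S * S}.

(* C t n m : capacity of link (n, m); x t n m k : jobs, or fraction of the
   capacity, for commodity k on link (n, m); lam t n k : arrivals at n of
   commodity k. *)
Implicit Types (C : nat -> S -> S -> R) (x a : nat -> S -> S -> S -> R).
Implicit Types (lam : nat -> S -> S -> R).

Fixpoint queue lam x (t : nat) (n k : S) : R :=
  if t is (_.+1 as s).+1 then
    if k == n then 0 else
      Num.max (queue lam x s n k - \sum_(m | (n, m) \in L) x s n m k) 0
      + \sum_(o | (o, n) \in L) x s o n k + lam s n k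
  else 0.

Definition queue_norm1 lam x (t : nat) : R :=
  \sum_n \sum_k `|queue lam x t n k|.

(* The decision of NSO for link (n, m) in round t, when the transmissions x were
   observed in the earlier rounds; it depends on C s and x s only for s < t. *)
Definition nso_action (pfol : olo_alg R S) (M : R) C lam x
    (t : nat) (n m : S) : S -> R :=
  let diff s := queue lam x s m \- queue lam x s n in
  adapfol pfol (fun s => M * normoo (diff s)) (fun s k => C s n m * diff s k) t.

Definition path_length a (t : nat) : R :=
  \sum_(1 <= s < t) \sum_(l in L) norm1 (a s l.1 l.2 \- a s.+1 l.1 l.2).

Definition is_interval_set (T : nat) (B : {set 'I_T.+1}) : Prop :=
  forall i j l : 'I_T.+1,
    i \in B -> l \in B -> (i <= j <= l)%N -> j \in B.

(* The inequality is required for k <> n only. Summed over all n for a fixed k,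
   flows cancel, so that requiring it for k = n as well would force
   epsW <= 0; jobs of commodity n are not queued at n. *)
Definition piecewise_stable (T : nat) (CW epsW : R) C lam a : Prop :=
  exists W : {set {set 'I_T.+1}},
  [/\ finset.partition W (finset (fun t : 'I_T.+1 => 0 < t)%N),
      (forall B, B \in W -> is_interval_set B),
      \sum_(B in W) (#|B|%:R - 1) ^+ 2 <= CW * T%:R
    & forall B, B \in W -> forall n k : S, k != n ->
        #|B|%:R^-1 * (\sum_(t in B) \sum_(m | (n, m) \in L) C t n m * a t n m k)
        >= epsW + #|B|%:R^-1 *
             (\sum_(t in B)
                (lam t n k + \sum_(o | (o, n) \in L) C t o n * a t o n k))].

End Network.

Section Conditioning.
Context d (Omega : measurableType d) {R : realType} (P : probability Omega R).

(* Y is a version of the conditional expectation of X given the sigma-algebra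
   generated by H. *)
Definition is_cond_exp (H : set_system Omega) (X Y : Omega -> R) : Prop :=
  [/\ measurable_fun [set: g_sigma_algebraType H] (Y : g_sigma_algebraType H -> R),
      P.-integrable [set: Omega] (EFin \o Y)
    & forall E : set Omega, <<s H >> E ->
        (\int[P]_(w in E) (X w)%:E = \int[P]_(w in E) (Y w)%:E)%E].

(* Mutual independence of (X i), i in D, given the sigma-algebra generated by H;
   subfamilies are covered by taking some of the sets B i equal to setT. *)
Definition cond_independent (H : set_system Omega) (I : finType) (D : {set I})
    (X : I -> Omega -> R) : Prop :=
  forall (B : I -> set R) (p : I -> Omega -> R),
    (forall i, measurable (B i)) ->
    (forall i, i \in D -> is_cond_exp H (\1_(X i @^-1` B i)) (p i)) ->
    is_cond_exp H (\1_(\bigcap_(i in [set` D]) (X i @^-1` B i)))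
      (fun w => \prod_(i in D) p i w).

End Conditioning.

Section Transmissions.
Context d (Omega : measurableType d) {R : realType} (P : probability Omega R).
Context {S : finType}.
Variables (L : {set S * S}) (mu : nat -> S -> S -> S -> {RV P >-> R}).

Definition realization (w : Omega) : nat -> S -> S -> S -> R :=
  fun t n m k => mu t n m k w.

(* Generators of the sigma-algebra of the transmissions before round t. *)
Definition history (t : nat) : set_system Omega :=
  [set E | exists s n m k (B : set R),
     [/\ (1 <= s < t)%N, (n, m) \in L, measurable B & E = mu s n m k @^-1` B]].

Definition nso_transmissions (pfol : olo_alg R S) (M : R)
    (C : nat -> S -> S -> R) (lam : nat -> S -> S -> R) (T : nat) : Prop :=
  forall t, (1 <= t <= T)%N ->
    [/\ (forall n m k w, (n, m) \in L -> 0 <= mu t n m k w <= M),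
        (forall n m k, (n, m) \in L ->
           is_cond_exp P (history t) (mu t n m k)
             (fun w => C t n m *
                       nso_action L pfol M C lam (realization w) t n m k))
      & cond_independent P (history t)
          (finset (fun i : S * S * S => i.1 \in L))
          (fun i => mu t i.1.1 i.1.2 i.2 : Omega -> R)].

End Transmissions.

(* Main.v *)
Require Import Defs.
From HB Require Import structures.
From mathcomp Require Import all_boot all_order all_algebra.
From mathcomp Require Import all_classical all_reals all_analysis.
From mathcomp Require Import measurable_realfun.
From mathcomp Require Import ring lra zify.

Set Implicit Arguments.
Unset Strict Implicit.
Unset Printing Implicit Defensive.

Import Order.TTheory GRing.Theory Num.Theory.
Import numFieldNormedType.Exports.

Local Open Scope classical_set_scope.
Local Open Scope ring_scope.

(** The proof is a Lyapunov drift argument with the sum of the squared queues. Its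
    one-round drift is, up to a second-order constant, at most minus twice the sum of
    the queues weighted by their net service. Rewritten as a sum over links, the
    expected net service under NSO is minus the linear loss that AdaPFOL
    receives: NSO maximizes the weighted service by online linear optimization.
    Replacing its decisions by the reference actions costs the dynamic regret,
    and by the stability assumption the reference actions serve the queues at a
    surplus epsW per round. The surplus is guaranteed on average over windows
    only; queues move by at most N M + Rlam per round, so treating them as frozen
    within a window costs the terms with CW. Summing over the rounds
    ([lyapunov_drift], [reference_surplus]), with S the sum of all queue lengths
    over the T rounds,
      epsW S + noise <= A T + regret,
    where A is the constant of the theorem up to the factor 1 / epsW.

    The regret depends on the size of the losses, that is, on the queues
    themselves. For AdaPFOL with losses of norm at most Z and total norm Y it is,
    up to the factor of T ^ (1/4 - eta) coming from the path length and the
    logarithm, at most Z + sqrt (Z Y) ([adapfol_regret]). A queue that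
    grows at bounded speed and reaches height Z has accumulated total length of
    order Z ^ 2 ([queue_norm1_sqr]); hence Z is of order sqrt S and the regret of
    order T ^ (- eta) * T ^ (1/4) * S ^ (3/4) <= T ^ (- eta) * (T + S). For
    large T its part in S is absorbed by epsW S, and the rest vanishes
    after division by T ([link_regret], [nso_drift]). All of this holds for every
    outcome.

    Expectations enter only at the end. The noise is a sum of differences between
    transmissions and their conditional means, multiplied by queue lengths that
    are determined by the past; it has mean zero ([zero_mean_noise]) because a
    bounded factor that is known from the past can be taken out of a conditional
    expectation ([zero_mean_cond_exp]). *)

(** * Norms and sums *)

Section Norms.
Context {R : realType} {I : finType}.
Implicit Types x y : I -> R.

Lemma norm1_ge0 x : 0 <= norm1 x.
Proof. by apply: sumr_ge0 => i _; exact: normr_ge0. Qed.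

Lemma normoo_ge0 x : 0 <= normoo x.
Proof.
by rewrite /normoo; elim/big_ind: _ => // a b a0 b0; rewrite le_max a0.
Qed.

Lemma le_normoo x i : `|x i| <= normoo x.
Proof. exact: (le_bigmax 0 (fun i => `|x i|) i). Qed.

Lemma normoo_le x (c : R) : 0 <= c -> (forall i, `|x i| <= c) -> normoo x <= c.
Proof. by move=> c0 xc; apply: bigmax_le. Qed.

Lemma normooZ (c : R) x : 0 <= c -> normoo (fun i => c * x i) <= c * normoo x.
Proof.
move=> c0; apply: normoo_le; first by rewrite mulr_ge0// normoo_ge0.
by move=> i; rewrite normrM (ger0_norm c0) ler_wpM2l// le_normoo.
Qed.

Lemma innerZ (c : R) x y : inner (fun i => c * x i) y = c * inner x y.
Proof. by rewrite /inner mulr_sumr; apply: eq_bigr => i _; rewrite mulrA. Qed.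

(** The supremum of a set without upper bound, or of the empty set, is 0. *)
Lemma diameter1_ge0 (X : set (I -> R)) : 0 <= diameter1 X.
Proof.
rewrite /diameter1; set E := [set r | _].
have E0 r : E r -> 0 <= r by move=> [x [y [_ _ ->]]]; exact: norm1_ge0.
have [sE|/sup_out->//] := pselect (has_sup E).
by have [[r Er] _] := sE; rewrite (le_trans (E0 r Er))// sup_upper_bound.
Qed.

Lemma norm1_simplex x : simplex R I x -> norm1 x = 1.
Proof.
by move=> [x0 <-]; apply: eq_bigr => i _; rewrite ger0_norm.
Qed.

Lemma simplex_le1 x i : simplex R I x -> x i <= 1.
Proof.
by move=> [x0 <-]; rewrite (bigD1 i)//= lerDl; apply: sumr_ge0 => j _.
Qed.

Lemma diameter1_simplex : diameter1 (simplex R I) <= 2.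
Proof.
rewrite /diameter1; set E := [set r | _].
have [->|E0] := eqVneq E set0; first by rewrite sup0.
apply: ge_sup; first exact/set0P.
move=> _ [x [y [Xx Xy ->]]].
have -> : 2 = norm1 x + norm1 y by rewrite !norm1_simplex.
rewrite /norm1 -big_split/=.
by apply: ler_sum => i _; exact: ler_normB.
Qed.

End Norms.

Section Sums.
Context {R : realType}.

Lemma ln_nat_ge0 (n : nat) : 0 <= ln n%:R :> R.
Proof.
case: n => [|n]; first by rewrite ln0.
by rewrite ln_ge0// ler1n.
Qed.

Lemma big_shift1 (F : nat -> R) (s k : nat) :
  \sum_(s.+1 <= t < s + k) F t = \sum_(1 <= t < k) F (s + t)%N.
Proof.
rewrite -[s.+1]add1n big_addn addKn.
by apply: eq_big_nat => t _; rewrite addnC.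
Qed.

Lemma sum_window_le (F : nat -> R) (s k e : nat) : (forall t, 0 <= F t) ->
  (s + k <= e)%N -> \sum_(1 <= t < k) F (s + t)%N <= \sum_(1 <= t < e) F t.
Proof.
move=> F0 ske; case: k ske => [|k] ske; first by rewrite big_geq// sumr_ge0.
rewrite -big_shift1.
rewrite (@big_cat_nat _ _ _ s.+1 1 e)//=; last by lia.
rewrite (@big_cat_nat _ _ _ (s + k.+1)%N s.+1 e)//=; last by lia.
by rewrite addrCA lerDl addr_ge0// sumr_ge0.
Qed.

End Sums.

(** * Dynamic regret of AdaPFOL *)

Section AdaPFOL.
Context {R : realType} {I : finType}.
Local Notation vec := (I -> R).
Variables (X : set vec) (K0 : R) (A : olo_alg R I).
Hypothesis PFOL : PFOL_guarantee X K0 A.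
Variables (T : nat) (G : nat -> R) (g u : nat -> vec) (Z : R).
Hypothesis gG : forall t, (1 <= t <= T)%N -> normoo (g t) <= G t.
Hypothesis Xu : forall t, (1 <= t <= T)%N -> X (u t).
Hypothesis GZ : forall t, (1 <= t <= T)%N -> G t <= Z.

(** The factors of the PFOL guarantee that do not depend on the losses. The
    logarithmic factor is bounded once and for all: losses fed to an instance
    have norm at most 1, so T * V <= T ^ 2 for the V of that guarantee. *)
Definition regret_scale : R :=
  `|K0| * (Num.sqrt (diameter1 X *
     (diameter1 X + \sum_(1 <= t < T) norm1 (u t \- u t.+1))) *
     (1 + 2 * ln T%:R)).

Definition total_loss : R := \sum_(1 <= t < T.+1) normoo (g t).

Let Pi := regret_scale.
Let Y := total_loss.

Lemma regret_scale_ge0 : 0 <= regret_scale.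
Proof.
rewrite /regret_scale !mulr_ge0 ?sqrtr_ge0//.
by rewrite addr_ge0// mulr_ge0// ln_nat_ge0.
Qed.

Lemma total_loss_ge0 : 0 <= total_loss.
Proof. by apply: sumr_ge0 => t _; exact: normoo_ge0. Qed.

(** The guarantee of one instance, in the original scale. Undoing the scaling by
    b turns the factor sqrt (1 + V) into sqrt (b ^ 2 + b ^ 2 V), and
    b ^ 2 V <= b Y because a scaled loss is at most 1, hence at least its
    square. Bounding by the sum of the norms, rather than by the sum of their
    squares, is what makes the epochs add up geometrically later. *)
Lemma epoch_regret (b : R) (s e : nat) : 1 <= b -> (s <= e <= T)%N ->
  (forall t, (s < t <= e)%N -> normoo (g t) <= b) ->
  \sum_(s.+1 <= t < e.+1)
     inner (g t) (A [seq (fun i => b^-1 * g j i) | j <- index_iota s.+1 t] \- u t)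
  <= Pi * (b + Num.sqrt (b * Y)).
Proof.
move=> b1 /andP[se eT] gb.
have b0 : 0 < b by rewrite (lt_le_trans _ b1).
have bn0 : b != 0 by rewrite gt_eqF.
pose g' (t : nat) : vec := fun i => b^-1 * g (s + t)%N i.
have [n esn] : exists n, e = (s + n)%N by exists (e - s)%N; rewrite subnKC.
have snT : (s + n <= T)%N by rewrite -esn.
have snT1 : (s + n.+1 <= T.+1)%N by rewrite addnS ltnS.
have nT : (n <= T)%N := leq_trans (leq_addl _ _) snT.
have T0n : T = 0%N -> n = 0%N by move=> T0; move: nT; rewrite T0; case: (n).
have g'le t : (1 <= t <= n)%N -> normoo (g' t) <= b^-1 * normoo (g (s + t)%N).
  by move=> _; apply: normooZ; rewrite invr_ge0 ltW.
have g'1 t : (1 <= t <= n)%N -> normoo (g' t) <= 1.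
  move=> tn; apply: (le_trans (g'le t tn)).
  by rewrite mulrC ler_pdivrMr// mul1r gb//; lia.
have Xu' t : (1 <= t <= n)%N -> X (u (s + t)%N) by move=> tn; apply: Xu; lia.
have /= := PFOL.2 n g' (fun t => u (s + t)%N) g'1 Xu'.
set V := \sum_(1 <= t < n.+1) normoo (g' t) ^+ 2.
set p := \sum_(1 <= t < n) _; set D := diameter1 X => H.
have D0 : 0 <= D := diameter1_ge0 X.
have p0 : 0 <= p by apply: sumr_ge0 => t _; exact: norm1_ge0.
have pP : p <= \sum_(1 <= t < T) norm1 (u t \- u t.+1).
  rewrite /p.
  under eq_bigr do rewrite addnS.
  rewrite (@sum_window_le R (fun t => norm1 (u t \- u t.+1)) s n T)//.
  by move=> t; exact: norm1_ge0.
have V0 : 0 <= V by apply: sumr_ge0 => t _; rewrite sqr_ge0.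
have VY : b * V <= Y.
  rewrite /V mulr_sumr.
  apply: (@le_trans _ _ (\sum_(1 <= t < n.+1) normoo (g (s + t)%N))).
    apply: ler_sum_nat => t tn.
    have t1 := g'1 t tn; have t2 := g'le t tn.
    have t0 := normoo_ge0 (g' t).
    apply: (@le_trans _ _ (b * normoo (g' t))).
      by rewrite ler_pM2l// expr2 ler_piMr.
    by rewrite -ler_pdivlMl.
  rewrite (@sum_window_le R (fun t => normoo (g t)) s n.+1 T.+1)//.
  by move=> t; exact: normoo_ge0.
have VT : V <= T%:R.
  apply: (@le_trans _ _ (\sum_(1 <= t < n.+1) 1)).
    apply: ler_sum_nat => t tn.
    by rewrite expr_le1// ?g'1// normoo_ge0.
  by rewrite sumr_const_nat subn1/= ler_nat.
have lnV : Num.max 1 (ln (n%:R * V)) <= 1 + 2 * ln T%:R.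
  have lT : 0 <= ln (T%:R : R) := ln_nat_ge0 T.
  rewrite ge_max lerDl mulr_ge0//=.
  have [nV0|nV0] := ltP 0 (n%:R * V); last first.
    by rewrite ln0// addr_ge0// mulr_ge0.
  have TT : n%:R * V <= T%:R ^+ 2 by rewrite expr2 ler_pM// ler_nat.
  have T0 : 0 < T%:R :> R.
    rewrite ltr0n lt0n; apply: contraTneq nV0 => T0.
    by rewrite (T0n T0) mul0r ltxx.
  rewrite (@le_trans _ _ (ln (T%:R ^+ 2)))//.
    by rewrite ler_ln// posrE exprn_gt0.
  by rewrite lnXn// mulr_natl lerDr.
have -> : \sum_(s.+1 <= t < e.+1) inner (g t)
     (A [seq (fun i => b^-1 * g j i) | j <- index_iota s.+1 t] \- u t) =
   b * \sum_(1 <= t < n.+1) inner (g' t) (olo_play A g' t \- u (s + t)%N).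
  rewrite esn -addnS big_shift1 mulr_sumr; apply: eq_big_nat => t tn.
  rewrite innerZ mulrA divff// mul1r /olo_play; congr (inner _ (A _ \- _)).
  rewrite /index_iota.
  rewrite subnS addKn -subn1.
  by rewrite -[s.+1]addn1 iotaDl -map_comp.
rewrite mulrC; apply: (@le_trans _ _ (Pi * Num.sqrt (1 + V) * b)).
  rewrite ler_pM2r//; apply: (le_trans H).
  rewrite /Pi /regret_scale -/D.
  set P := \sum_(1 <= t < T) _ in pP *.
  rewrite -[X in _ <= X]mulrA [X in _ <= _ * X]mulrAC.
  apply: (@le_trans _ _ (`|K0| * (Num.sqrt (D * (D + p)) * Num.sqrt (1 + V) *
     Num.max 1 (ln (n%:R * V))))).
    by rewrite ler_wpM2r ?ler_norm// !mulr_ge0 ?sqrtr_ge0// le_max ler01.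
  rewrite ler_wpM2l// ler_pM ?mulr_ge0 ?sqrtr_ge0 ?le_max ?ler01//.
  rewrite ler_wpM2r ?sqrtr_ge0// ler_wsqrtr// ler_wpM2l// lerD2l.
  exact: pP.
rewrite -mulrA ler_wpM2l ?regret_scale_ge0//.
have sVb : Num.sqrt (1 + V) * b = Num.sqrt ((1 + V) * b ^+ 2).
  by rewrite sqrtrM ?addr_ge0// sqrtr_sqr gtr0_norm.
have bY0 : 0 <= b * Y by rewrite mulr_ge0 ?total_loss_ge0// ltW.
rewrite sVb -[leRHS]ger0_norm; last by rewrite addr_ge0 ?sqrtr_ge0 1?ltW.
rewrite -sqrtr_sqr ler_wsqrtr// sqrrD sqr_sqrtr//.
have := sqrtr_ge0 (b * Y); nra.
Qed.

(** Round s is the last one before the current instance was started. The regret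
    of all earlier instances is paid for by the current magnitude bound b: that
    bound at least doubles at every reset, so both b and sqrt (b Y) grow at
    least geometrically, by factors 2 and sqrt 2. The constant 3 is one for
    which the invariant survives a reset, as 3 + 1 <= 3 sqrt 2. *)
Let adapfol_inv (t : nat) (st : adapfol_state) (s : nat) : Prop :=
  [/\ (s <= t)%N, 1 <= st.1 <= 1 + 2 * Z,
     st.2 = [seq (fun i => st.1^-1 * g j i) | j <- index_iota s.+1 t.+1],
     (forall j, (s < j <= t)%N -> normoo (g j) <= st.1 /\
        adapfol A G g j =
          A [seq (fun i => st.1^-1 * g k i) | k <- index_iota s.+1 j])
   & \sum_(1 <= j < s.+1) inner (g j) (adapfol A G g j \- u j) <=
     Pi * (st.1 + 3 * Num.sqrt (st.1 * Y))].

Lemma adapfol_inv_regret t st s : (t <= T)%N -> adapfol_inv t st s ->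
  \sum_(1 <= j < t.+1) inner (g j) (adapfol A G g j \- u j) <=
     Pi * (2 * st.1 + 4 * Num.sqrt (st.1 * Y)).
Proof.
move=> tT [st_ /andP[b1 bZ] h2 hj hs].
rewrite (@big_cat_nat _ _ _ s.+1)//=.
have -> : 2 * st.1 + 4 * Num.sqrt (st.1 * Y) =
   (st.1 + 3 * Num.sqrt (st.1 * Y)) + (st.1 + Num.sqrt (st.1 * Y)) by ring.
rewrite mulrDr lerD//.
have stT : (s <= t <= T)%N by rewrite st_ tT.
have H := epoch_regret b1 stT (fun j jst => (hj j jst).1).
apply: le_trans H; rewrite le_eqVlt; apply/orP; left; apply/eqP.
by apply: eq_big_nat => j jst; rewrite (hj j jst).2.
Qed.

Hypothesis Z0 : 0 <= Z.

Lemma adapfol_invP t : (t <= T)%N ->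
  exists s, adapfol_inv t (adapfol_before G g t.+1) s.
Proof.
elim: t => [|t IH] tT.
  exists 0%N; split => //=.
  - by rewrite lexx lerDl mulr_ge0.
  - by move=> j; case: j.
  - rewrite big_geq//; have := sqrtr_ge0 (1 * Y); have := regret_scale_ge0.
    by move=> P0 s0; rewrite mulr_ge0//; lra.
have [s inv_s] := IH (ltnW tT).
have reg := adapfol_inv_regret (ltnW tT) inv_s.
have tT1 : (1 <= t.+1 <= T)%N by [].
have Gt := GZ tT1; have gt := gG tT1.
case: inv_s => st_ bb h2 hj hs.
have playE : adapfol A G g t.+1 =
  A (adapfol_receive (G t.+1) (adapfol_before G g t.+1)).2 by [].
have beforeE : adapfol_before G g t.+2 =
  adapfol_feed (g t.+1) (adapfol_receive (G t.+1) (adapfol_before G g t.+1))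
  by [].
rewrite beforeE; move: bb h2 hj hs reg playE; rewrite /adapfol_receive.
move=> {beforeE}.
move: (adapfol_before G g t.+1) => [b h]/= /andP[b1 bZ] h2 hj hs reg.
case: ltP => Gb /= playE.
- exists t; split => //=.
  + by apply/andP; split; [lra|rewrite (le_trans (y := 2 * Z))//; lra].
  + by rewrite /index_iota subSnn.
  + move=> j /andP[tj jt]; have {j tj jt} -> : j = t.+1.
      by apply/eqP; rewrite eqn_leq jt.
    by split; [lra|rewrite playE /index_iota subnn].
  + apply: (le_trans reg); rewrite ler_wpM2l ?regret_scale_ge0//.
    (* the reset: 2 b + 4 sqrt (b Y) <= 2 G + 3 sqrt (2 G Y) since b < G *)
    have bY0 : 0 <= b * Y by rewrite mulr_ge0 ?total_loss_ge0//; lra.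
    have GY : 2 * (b * Y) <= 2 * G t.+1 * Y.
      by rewrite mulrA ler_wpM2r ?total_loss_ge0//; lra.
    have GY0 : 0 <= 2 * G t.+1 * Y by lra.
    have := sqr_sqrtr bY0; have := sqr_sqrtr GY0.
    have := sqrtr_ge0 (b * Y); have := sqrtr_ge0 (2 * G t.+1 * Y).
    move: (Num.sqrt (b * Y)) (Num.sqrt (2 * G t.+1 * Y)) => p q q0 p0 qE pE.
    have : (4 * p) ^+ 2 <= (3 * q) ^+ 2 by rewrite !exprMn qE pE; lra.
    by rewrite ler_pXn2r// ?nnegrE ?mulr_ge0// => pq; lra.
- exists s; split => //=.
  + exact: leq_trans st_ _.
  + by rewrite b1.
  + rewrite h2 /index_iota !subSS subSn// -(addn1 (t - s)).
    by rewrite iotaD map_cat/= cats1 addSn subnKC.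
  + move=> j /andP[sj]; rewrite leq_eqVlt => /orP[/eqP ->|jt].
      by split; [lra|rewrite playE h2].
    by apply: hj; rewrite sj.
Qed.

(** No logarithm of the number of resets is lost, since the bounds of the
    successive instances form a series dominated by its last term. *)
Lemma adapfol_regret :
  \sum_(1 <= t < T.+1) inner (g t) (adapfol A G g t \- u t) <=
     regret_scale * (2 * (1 + 2 * Z) + 4 * Num.sqrt ((1 + 2 * Z) * total_loss)).
Proof.
have [s inv_s] := adapfol_invP (leqnn T).
apply: (le_trans (adapfol_inv_regret (leqnn T) inv_s)).
case: inv_s => _ /andP[b1 bZ] _ _ _.
rewrite ler_wpM2l ?regret_scale_ge0// lerD ?ler_wpM2l// ler_wsqrtr//.
by rewrite ler_wpM2r ?total_loss_ge0.
Qed.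

End AdaPFOL.

(** * Queues: drift, reference flow and growth *)

Section Queues.
Context {R : realType} {S : finType}.
Variables (L : {set S * S}) (M Rlam : R) (T : nat).
Variables (lam : nat -> S -> S -> R) (x : nat -> S -> S -> S -> R).
Hypotheses (M0 : 0 <= M) (Rlam0 : 0 <= Rlam).
Hypothesis lamP : forall t n k, (1 <= t <= T)%N -> 0 <= lam t n k <= Rlam.
Hypothesis xP : forall t n m k, (1 <= t <= T)%N -> (n, m) \in L ->
  0 <= x t n m k <= M.

Let N : R := #|S|%:R.
(* the largest change of a queue in one round *)
Let incr : R := N * M + Rlam.
Let Q := queue L lam x.

Definition outflow (f : nat -> S -> S -> S -> R) t n k : R :=
  \sum_(m | (n, m) \in L) f t n m k.
Definition inflow (f : nat -> S -> S -> S -> R) t n k : R :=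
  \sum_(o | (o, n) \in L) f t o n k.

Lemma sum_pred_le (P : pred S) (F : S -> R) (c : R) : 0 <= c ->
  (forall i, P i -> 0 <= F i <= c) -> 0 <= \sum_(i | P i) F i <= N * c.
Proof.
move=> c0 Fc; apply/andP; split.
  by apply: sumr_ge0 => i /Fc /andP[].
apply: (@le_trans _ _ (\sum_(i : S) c)).
  rewrite big_mkcond; apply: ler_sum => i _.
  by case: ifPn => // /Fc /andP[].
by rewrite sumr_const cardT -cardE mulr_natl.
Qed.

Lemma outflowP f t n k : (forall m, (n, m) \in L -> 0 <= f t n m k <= M) ->
  0 <= outflow f t n k <= N * M.
Proof. by move=> fP; apply: sum_pred_le. Qed.

Lemma inflowP f t n k : (forall o, (o, n) \in L -> 0 <= f t o n k <= M) ->
  0 <= inflow f t n k <= N * M.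
Proof. by move=> fP; apply: sum_pred_le. Qed.

Lemma NM_ge0 : 0 <= N * M. Proof. by rewrite mulr_ge0// ler0n. Qed.
Lemma incr_ge0 : 0 <= incr. Proof. by rewrite addr_ge0// NM_ge0. Qed.

Lemma queueS t n k : (0 < t)%N -> k != n ->
  Q t.+1 n k = Num.max (Q t n k - outflow x t n k) 0 + inflow x t n k + lam t n k.
Proof. by case: t => // t _ /negbTE kn; rewrite /Q/= kn. Qed.

Lemma queue_self t n : Q t n n = 0.
Proof. by case: t => [//|[//|t]]; rewrite /Q/= eqxx. Qed.

Lemma queue_ge0 t n k : (t <= T.+1)%N -> 0 <= Q t n k.
Proof.
case: t => [//|[//|t]] tT; have [->|kn] := eqVneq k n; first by rewrite queue_self.
have t1 : (1 <= t.+1 <= T)%N by [].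
rewrite queueS//.
have /andP[i0 _] := inflowP (fun o => @xP t.+1 o n k t1).
have /andP[l0 _] := lamP n k t1.
by rewrite !addr_ge0// le_max lexx orbT.
Qed.

Lemma queue_lip1 t n k : (1 <= t <= T)%N -> `|Q t.+1 n k - Q t n k| <= incr.
Proof.
move=> tT; have [->|kn] := eqVneq k n.
  by rewrite !queue_self subrr normr0 incr_ge0.
have /andP[t0 tT'] := tT.
rewrite queueS//.
have /andP[i0 i1] := inflowP (fun o => @xP t o n k tT).
have /andP[u0 u1] := outflowP (fun m => @xP t n m k tT).
have /andP[l0 l1] := lamP n k tT.
have q0 : 0 <= Q t n k by apply: queue_ge0; rewrite ltnW.
rewrite /incr ler_norml; have R0 := Rlam0.
by case: (lerP (Q t n k - outflow x t n k) 0) => h; apply/andP; split; lra.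
Qed.

Lemma queue_lip s t n k : (1 <= s)%N -> (s <= t <= T.+1)%N ->
  `|Q t n k - Q s n k| <= (t - s)%:R * incr.
Proof.
move=> s1; elim: t => [|t IH] /andP[st tT].
  by have := leq_trans s1 st.
move: st; rewrite leq_eqVlt => /orP[/eqP <-|].
  by rewrite subrr normr0 subnn mul0r.
rewrite ltnS => st.
have -> : Q t.+1 n k - Q s n k = (Q t.+1 n k - Q t n k) + (Q t n k - Q s n k).
  by rewrite addrA subrK.
rewrite (le_trans (ler_normD _ _))// subSn// -(addn1 (t - s)) natrD mulrDl mul1r.
rewrite addrC lerD//; first by rewrite IH// st ltnW.
by rewrite queue_lip1// (leq_trans s1 st).
Qed.

(** Truncation at 0 only helps: its square is at most the square of the
    untruncated value, and it is at most the queue itself, which gives the cross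
    term with the arrivals. *)
Lemma queue_drift t n k : (1 <= t <= T)%N ->
  Q t.+1 n k ^+ 2 <= Q t n k ^+ 2
    - 2 * (Q t n k * (outflow x t n k - inflow x t n k - lam t n k))
    + ((N * M) ^+ 2 + incr ^+ 2).
Proof.
move=> tT; have NM0 := NM_ge0; have R0 := Rlam0; have [->|kn] := eqVneq k n.
  rewrite !queue_self expr0n/= mul0r mulr0 subr0 add0r.
  by rewrite addr_ge0// sqr_ge0.
have /andP[t0 tT'] := tT.
rewrite queueS//.
have /andP[i0 i1] := inflowP (fun o => @xP t o n k tT).
have /andP[u0 u1] := outflowP (fun m => @xP t n m k tT).
have /andP[l0 l1] := lamP n k tT.
have q0 : 0 <= Q t n k by apply: queue_ge0; rewrite ltnW.
move: (outflow x t n k) (inflow x t n k) (lam t n k) (Q t n k) i0 i1 u0 u1 l0 l1 q0.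
move=> o i l q i0 i1 u0 u1 l0 l1 q0.
have o2 : o ^+ 2 <= (N * M) ^+ 2 by rewrite ler_pXn2r ?nnegrE.
have il2 : (i + l) ^+ 2 <= incr ^+ 2.
  by rewrite ler_pXn2r ?nnegrE ?addr_ge0// lerD.
have ov0 : 0 <= o * (i + l) by rewrite mulr_ge0// addr_ge0.
have [h|h] := lerP (q - o) 0.
  rewrite add0r. have q2 := sqr_ge0 (q - o).
  have qil : 0 <= q * (i + l) by rewrite mulr_ge0// addr_ge0.
  by move: il2 o2 q2 qil; nra.
by move: il2 o2 ov0; nra.
Qed.

(** The queues weighted by the net service that a flow f provides: minus half the
    first-order part of the drift of the sum of the squared queues. *)
Definition queue_dot (f : nat -> S -> S -> S -> R) t : R :=
  \sum_n \sum_k Q t n k * (outflow f t n k - inflow f t n k - lam t n k).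

Lemma sum_pairs (F : S -> S -> R) (c : R) : (forall n k, F n k <= c) ->
  \sum_n \sum_k F n k <= N ^+ 2 * c.
Proof.
move=> Fc; apply: (@le_trans _ _ (\sum_(n : S) \sum_(k : S) c)).
  by apply: ler_sum => n _; apply: ler_sum => k _.
rewrite !sumr_const cardT -cardE -mulrnA -mulr_natl.
by rewrite natrM expr2.
Qed.

(** The squared queues start at 0 and never become negative, so the first-order
    drifts sum up to at most the second-order terms. *)
Lemma lyapunov_drift :
  \sum_(1 <= t < T.+1) queue_dot x t <=
    T%:R * (N ^+ 2 * ((N * M) ^+ 2 + incr ^+ 2) / 2).
Proof.
pose V t := \sum_n \sum_k Q t n k ^+ 2.
set c := N ^+ 2 * ((N * M) ^+ 2 + incr ^+ 2).
have step t : (1 <= t <= T)%N -> 2 * queue_dot x t <= V t - V t.+1 + c.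
  move=> tT.
  suff : V t.+1 - V t + 2 * queue_dot x t <= c by move=> h; lra.
  rewrite /V /queue_dot -sumrB mulr_sumr -big_split/=.
  under eq_bigr do rewrite -sumrB mulr_sumr -big_split/=.
  apply: sum_pairs => n k.
  by have := queue_drift n k tT; lra.
have V1 : V 1%N = 0 by rewrite /V !big1// => n _; rewrite big1// => k _; rewrite expr0n.
have VT : 0 <= V T.+1.
  by apply: sumr_ge0 => n _; apply: sumr_ge0 => k _; exact: sqr_ge0.
have : \sum_(1 <= t < T.+1) (2 * queue_dot x t) <=
       \sum_(1 <= t < T.+1) (V t - V t.+1 + c).
  exact: ler_sum_nat.
rewrite -mulr_sumr big_split/= sumr_const_nat subn1/=.
rewrite -mulr_natl.
have -> : \sum_(1 <= t < T.+1) (V t - V t.+1) = V 1%N - V T.+1.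
  rewrite -[LHS]opprK -sumrN; under eq_bigr do rewrite opprB.
  by rewrite telescope_sumr// opprB.
by rewrite V1; lra.
Qed.

(** A job moved over a link (n, m) trades the weight of n for that of m: this
    turns a sum over queues into a sum over links, on which NSO decides. *)
Lemma flow_dot (q : S -> S -> R) (f : S -> S -> S -> R) :
  \sum_n \sum_k q n k *
     (\sum_(m | (n, m) \in L) f n m k - \sum_(o | (o, n) \in L) f o n k) =
  \sum_(l in L) \sum_k f l.1 l.2 k * (q l.1 k - q l.2 k).
Proof.
have pairL (F : S * S -> R) :
    \sum_(l in L) F l = \sum_n \sum_(m | (n, m) \in L) F (n, m).
  by rewrite pair_big_dep/=; apply: eq_big => [[]|[]].
under [RHS]eq_bigr do under eq_bigr do rewrite mulrBr.
under [RHS]eq_bigr do rewrite sumrB.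
rewrite sumrB.
under eq_bigr do under eq_bigr do rewrite mulrBr.
under eq_bigr do rewrite sumrB.
rewrite sumrB; congr (_ - _).
  rewrite pairL; apply: eq_bigr => n _; rewrite exchange_big/=.
  by apply: eq_bigr => k _; rewrite mulr_sumr; apply: eq_bigr => m _; rewrite mulrC.
rewrite pairL [RHS](exchange_big_dep predT)//=; apply: eq_bigr => n _.
rewrite [RHS]exchange_big/=; apply: eq_bigr => k _; rewrite mulr_sumr.
by apply: eq_bigr => o _; rewrite mulrC.
Qed.

Lemma interval_card (B : {set 'I_T.+1}) (i l : 'I_T.+1) : is_interval_set B ->
  i \in B -> l \in B -> (i <= l)%N -> (l - i < #|B|)%N.
Proof.
move=> BI iB lB il.
pose f (k : 'I_(l - i).+1) : 'I_T.+1 := inord (i + k).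
have fE (k : 'I_(l - i).+1) : (i <= f k <= l)%N /\ (f k = i + k :> nat)%N.
  have kl : (i + k <= l)%N by rewrite -leq_subRL// -ltnS.
  rewrite /f inordK; last by rewrite (leq_ltn_trans kl).
  by rewrite leq_addr kl.
have finj : injective f.
  move=> a b ab; apply/val_inj/(@addnI i).
  by rewrite -(fE a).2 -(fE b).2 ab.
rewrite -[X in (X <= _)%N]card_ord -(card_imset predT finj).
apply: subset_leq_card; apply/fintype.subsetP => _ /imsetP[k _ ->].
exact: (BI i _ l iB lB (fE k).1).
Qed.

(** Within a window the queue stays within (|B| - 1) incr of its value at any
    fixed round of the window. Freezing it there, both in the sum with s and in
    the sum with eps, makes the average condition on s applicable. The price is
    of order |B| (|B| - 1), which is at most 2 (|B| - 1) ^ 2 for an integer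
    |B| > 0. *)
Lemma window_entry (B : {set 'I_T.+1}) (s : nat -> R) (eps : R) (n k : S) :
  0 <= eps -> is_interval_set B -> (forall t, t \in B -> (0 < t)%N) ->
  (forall t, t \in B -> `|s t| <= incr) ->
  (k != n -> eps <= #|B|%:R^-1 * \sum_(t in B) s t) ->
  eps * (\sum_(t in B) Q t n k) - (incr ^+ 2 + eps * incr) * (2 * (#|B|%:R - 1) ^+ 2)
    <= \sum_(t in B) Q t n k * s t.
Proof.
move=> eps0 BI Bpos s_le seps.
have incr0 := incr_ge0.
have c0 : 0 <= incr ^+ 2 + eps * incr by rewrite addr_ge0 ?sqr_ge0// mulr_ge0.
have slack0 : 0 <= (incr ^+ 2 + eps * incr) * (2 * (#|B|%:R - 1) ^+ 2).
  by rewrite mulr_ge0// mulr_ge0// sqr_ge0.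
have [->|kn] := eqVneq k n.
  rewrite !big1; first last.
  - by move=> t _; rewrite queue_self.
  - by move=> t _; rewrite queue_self mul0r.
  by rewrite mulr0 sub0r oppr_le0.
have [Bempty|[t0 t0B]] := set_0Vmem B.
  rewrite [in X in X - _]Bempty [leRHS]big1 => [|t]; last by rewrite Bempty inE.
  by rewrite big_set0 mulr0 sub0r oppr_le0.
have cardB : (0 < #|B|)%N by apply/card_gt0P; exists t0.
have cB : 1 <= #|B|%:R :> R by rewrite ler1n.
have lip (t : 'I_T.+1) : t \in B -> `|Q t n k - Q t0 n k| <= (#|B|%:R - 1) * incr.
  move=> tB.
  have main (a b : 'I_T.+1) : a \in B -> b \in B -> (a <= b)%N ->
      `|Q b n k - Q a n k| <= (#|B|%:R - 1) * incr.
    move=> aB bB ab.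
    have abT : (a <= b <= T.+1)%N by rewrite ab ltnW.
    apply: (le_trans (queue_lip n k (Bpos _ aB) abT)).
    rewrite ler_wpM2r// lerBrDr natr1 ler_nat.
    exact: interval_card BI aB bB ab.
  by have [/main->//|/ltnW/main] := leqP t0 t; rewrite distrC => ->.
have S1 : \sum_(t in B) (Q t0 n k * s t - (#|B|%:R - 1) * incr ^+ 2) <=
          \sum_(t in B) Q t n k * s t.
  apply: ler_sum => t tB.
  have H : `|(Q t n k - Q t0 n k) * s t| <= (#|B|%:R - 1) * incr * incr.
    by rewrite normrM ler_pM// ?lip// s_le.
  have := ler_norm (- ((Q t n k - Q t0 n k) * s t)); rewrite normrN.
  lra.
have S2 : \sum_(t in B) Q t n k <= \sum_(t in B) (Q t0 n k + (#|B|%:R - 1) * incr).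
  apply: ler_sum => t tB; rewrite -lerBlDl.
  exact: le_trans (ler_norm _) (lip t tB).
have S3 : eps * #|B|%:R <= \sum_(t in B) s t.
  by rewrite mulrC -ler_pdivlMl ?seps// ltr0n.
have q0 : 0 <= Q t0 n k by apply: queue_ge0; rewrite ltnW.
have S4 : Q t0 n k * (eps * #|B|%:R) <= Q t0 n k * \sum_(t in B) s t.
  by rewrite ler_wpM2l.
have sumc (a : R) : \sum_(t in B) a = #|B|%:R * a by rewrite sumr_const mulr_natl.
move: S1 S2; rewrite big_split/= -mulr_sumr !sumc.
set c : R := #|B|%:R in cB S3 S4 *.
(* false for real c in ]1, 2[: that the cardinal is an integer is used here *)
have key : c * (c - 1) <= 2 * (c - 1) ^+ 2.
  have [B1|B1] := leqP #|B| 1.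
    have /eqP cB1 : #|B| == 1%N by rewrite eqn_leq B1.
    have -> : c = 1 by rewrite /c cB1.
    by rewrite subrr mulr0 expr0n mulr0.
  have : 2 <= c by rewrite /c ler_nat.
  rewrite -subr_ge0 => c2.
  have : 0 <= (c - 1) * (c - 2) by rewrite mulr_ge0// subr_ge0.
  lra.
move=> S1 S2.
have E := ler_wpM2l eps0 S2; have K2 := ler_wpM2l c0 key.
by move: S1 S4 E K2; lra.
Qed.

Lemma queue_dotB f f' t : queue_dot f t - queue_dot f' t =
  \sum_(l in L) \sum_k (f t l.1 l.2 k - f' t l.1 l.2 k) *
    (Q t l.1 k - Q t l.2 k).
Proof.
rewrite -(flow_dot (Q t) (fun n m k => f t n m k - f' t n m k)).
rewrite /queue_dot -sumrB; apply: eq_bigr => n _; rewrite -sumrB.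
apply: eq_bigr => k _; rewrite !sumrB -mulrBr /outflow /inflow; congr (_ * _).
ring.
Qed.

Lemma sum_partition (W : {set {set 'I_T.+1}}) (F : nat -> R) :
  finset.partition W (finset (fun t : 'I_T.+1 => 0 < t)%N) ->
  \sum_(1 <= t < T.+1) F t = \sum_(B in W) \sum_(t in B) F t.
Proof.
move=> /and3P[/eqP cW tW _]; rewrite -(finset.big_trivIset _ tW) cW.
by rewrite big_geq_mkord; apply: eq_bigl => t; rewrite inE.
Qed.

(** The stability assumption pays for the reference flow: served by it, the queues
    would decrease at rate epsW times their total. *)
Lemma reference_surplus (CW epsW : R) C aref : 0 <= epsW ->
  (forall t n m, (1 <= t <= T)%N -> (n, m) \in L -> 0 <= C t n m <= M) ->
  (forall t n m, (1 <= t <= T)%N -> (n, m) \in L -> simplex R S (aref t n m)) ->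
  piecewise_stable L T CW epsW C lam aref ->
  epsW * (\sum_(1 <= t < T.+1) queue_norm1 L lam x t)
    - N ^+ 2 * (incr ^+ 2 + epsW * incr) * (2 * (CW * T%:R)) <=
  \sum_(1 <= t < T.+1) queue_dot (fun t n m k => C t n m * aref t n m k) t.
Proof.
move=> eps0 CP aP [W [Wpart WI Wsq Wstab]].
set f := fun t n m k => C t n m * aref t n m k.
have fP t n m k : (1 <= t <= T)%N -> (n, m) \in L -> 0 <= f t n m k <= M.
  move=> tT nm; have /andP[C0 CM] := CP t n m tT nm; have sa := aP t n m tT nm.
  have [a0 _] := sa; have a1 := simplex_le1 k sa.
  rewrite mulr_ge0// ?a0//= -[leRHS]mulr1 ler_pM ?a0//.
have Wpos B t : B \in W -> t \in B -> (0 < t)%N.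
  move=> BW tB; have /and3P[/eqP cW _ _] := Wpart.
  have : t \in finset.cover W by apply/bigcupP; exists B.
  by rewrite cW inE.
have incr0 := incr_ge0.
have c0 : 0 <= incr ^+ 2 + epsW * incr by rewrite addr_ge0 ?sqr_ge0// mulr_ge0.
rewrite !(sum_partition _ Wpart) mulr_sumr.
apply: (@le_trans _ _ (\sum_(B in W) (epsW * (\sum_(t in B) queue_norm1 L lam x t)
   - N ^+ 2 * ((incr ^+ 2 + epsW * incr) * (2 * (#|B|%:R - 1) ^+ 2))))).
  rewrite sumrB lerD2l lerN2 -!mulr_sumr -!mulrA.
  rewrite ler_wpM2l ?sqr_ge0// ler_wpM2l//.
  by rewrite ler_wpM2l// ler_wpM2l.
apply: (@ler_sum R) => B BW.
pose s t n k := outflow f t n k - inflow f t n k - lam t n k.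
have E n k := @window_entry B (s ^~ n ^~ k) epsW n k eps0 (WI B BW)
  (fun t => @Wpos B t BW).
rewrite lerBlDr -lerBlDl.
have -> : epsW * (\sum_(t in B) queue_norm1 L lam x t) -
    \sum_(t in B) queue_dot f t =
  \sum_n \sum_k (epsW * (\sum_(t in B) Q t n k) - \sum_(t in B) Q t n k * s t n k).
  rewrite /queue_norm1 /queue_dot exchange_big/= [X in _ - X]exchange_big/=.
  rewrite mulr_sumr -sumrB; apply: eq_bigr => n _.
  rewrite exchange_big/= [X in _ - X]exchange_big/=.
  rewrite mulr_sumr -sumrB; apply: eq_bigr => k _.
  congr (_ * _ - _); apply: eq_bigr => t tB.
  by rewrite ger0_norm// queue_ge0// ltnW.
apply: sum_pairs => n k.
rewrite lerBlDr -lerBlDl; apply: E.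
- move=> t tB; have tT : (1 <= t <= T)%N by rewrite (Wpos B)//= -ltnS.
  have /andP[u0 u1] := outflowP (fun m => @fP t n m k tT).
  have /andP[i0 i1] := inflowP (fun o => @fP t o n k tT).
  have /andP[l0 l1] := lamP n k tT.
  by have R0 := Rlam0; rewrite /s /incr ler_norml; apply/andP; split; lra.
- move=> kn; have := Wstab B BW n k kn; rewrite -lerBrDr -mulrBr -sumrB.
  move=> /le_trans; apply; rewrite ler_wpM2l ?invr_ge0//.
  by apply: ler_sum => t _; rewrite /s /outflow /inflow; lra.
Qed.

Local Notation q := (queue_norm1 L lam x).

Lemma queue_norm1_ge0 t : 0 <= q t.
Proof. by apply: sumr_ge0 => n _; apply: sumr_ge0 => k _. Qed.

Lemma queue_norm1S t : (1 <= t <= T)%N -> q t.+1 <= q t + N ^+ 2 * incr.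
Proof.
move=> tT; rewrite -lerBlDl /queue_norm1 -sumrB.
under eq_bigr do rewrite -sumrB.
apply: sum_pairs => n k.
exact: le_trans (lerB_dist _ _) (queue_lip1 n k tT).
Qed.

(** Queues that grow at bounded speed from 0 cannot be large without having been
    large for long: the square of the last value is controlled by the sum of all
    values so far. *)
Lemma queue_norm1_sqr t : (1 <= t <= T)%N ->
  q t ^+ 2 <= 2 * (N ^+ 2 * incr) * \sum_(1 <= s < t.+1) q s.
Proof.
have q1 : q 1%N = 0.
  by rewrite /queue_norm1 big1// => n _; rewrite big1// => k _; rewrite /= normr0.
have Nincr0 : 0 <= N ^+ 2 * incr by rewrite mulr_ge0 ?sqr_ge0 ?incr_ge0.
elim: t => [//|[|t] IH] tT.
  by rewrite q1 expr0n/= big_nat1 q1 mulr0.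
rewrite big_nat_recr//= mulrDr.
have tT' : (1 <= t.+1 <= T)%N by rewrite /= ltnW.
have step := queue_norm1S tT'.
have := IH tT'; have := queue_norm1_ge0 t.+1; have := queue_norm1_ge0 t.+2.
move: (q t.+1) (q t.+2) (\sum_(1 <= s < t.+2) q s) (N ^+ 2 * incr) Nincr0 step.
move=> a b s c c0 bac b0 a0 as_.
apply: le_trans (lerD as_ (lexx _)).
(* only an increase of q matters, and then b ^ 2 - a ^ 2 <= c (a + b) *)
have [ba|ab] := lerP b a.
  rewrite (@le_trans _ _ (a ^+ 2))// ?ler_pXn2r ?nnegrE// lerDl.
  by rewrite !mulr_ge0.
rewrite -lerBlDl subr_sqr.
apply: (@le_trans _ _ (c * (b + b))); last by lra.
have a_b := ltW ab.
by apply: ler_pM; [rewrite subr_ge0|exact: addr_ge0|rewrite lerBlDl|rewrite lerD2l].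
Qed.

Lemma queue_norm1_sup t : (1 <= t <= T)%N ->
  q t <= Num.sqrt (2 * (N ^+ 2 * incr) * \sum_(1 <= s < T.+1) q s).
Proof.
move=> /[dup] tT /andP[t1 tT'].
rewrite -[leLHS]ger0_norm ?queue_norm1_ge0// -sqrtr_sqr ler_wsqrtr//.
apply: (le_trans (queue_norm1_sqr tT)).
have Nincr0 : 0 <= N ^+ 2 * incr by rewrite mulr_ge0 ?sqr_ge0 ?incr_ge0.
apply: ler_wpM2l; first exact: mulr_ge0.
rewrite [leRHS](@big_cat_nat _ _ _ t.+1)//=.
by rewrite lerDl sumr_ge0// => s _; exact: queue_norm1_ge0.
Qed.

Lemma queue_norm1_lin t : (1 <= t <= T.+1)%N -> q t <= N ^+ 2 * incr * t%:R.
Proof.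
elim: t => [//|[|t] IH] tT.
  rewrite /queue_norm1 big1 ?mulr1 ?mulr_ge0 ?sqr_ge0 ?incr_ge0// => n _.
  by rewrite big1// => k _; rewrite /= normr0.
have tT' : (1 <= t.+1 <= T)%N by [].
rewrite (le_trans (queue_norm1S tT'))// -[t.+2%:R]natr1 (mulrDr _ t.+1%:R) mulr1 lerD2r.
by apply: IH; rewrite /= ltnW.
Qed.

End Queues.

(** * Rates in the number of rounds *)

Section Rates.
Context {R : realType}.
Implicit Types (M B X s : R).

Definition regret_const M B : R :=
  (2 + 2 * M + 4 * M * B) + 4 * (1 + 2 * M ^+ 2 + 16 * M ^+ 4 * B).

Lemma regret_const_ge0 M B : 0 <= M -> 0 <= B -> 0 <= regret_const M B.
Proof.
move=> M0 B0; rewrite /regret_const.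
by rewrite !(addr_ge0, mulr_ge0, exprn_ge0).
Qed.

(** The self-bounding step. With X of order sqrt s, the left-hand side is of order
    tau * (1 + s ^ (3/4)), which the inequality between arithmetic and geometric
    means bounds by a multiple of tau ^ 4 + s. It will be used for tau = T ^ (1/4) and
    s the total queue length, so that the regret is absorbed by the drift
    without any moment inequality. *)
Lemma fourth_root_bound M B (tau s X : R) :
  0 <= M -> 0 <= B -> 1 <= tau -> 0 <= s -> 0 <= X -> X ^+ 2 = 2 * B * s ->
  tau * (2 * (1 + 2 * (M * X)) + 4 * Num.sqrt ((1 + 2 * (M * X)) * (M * s))) <=
  regret_const M B * (tau ^+ 4 + s).
Proof.
move=> M0 B0 tau1 s0 X0 X2.
have tau0 : 0 <= tau by lra.
set z := Num.sqrt ((1 + 2 * (M * X)) * (M * s)).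
have w0 : 0 <= (1 + 2 * (M * X)) * (M * s) by rewrite mulr_ge0 ?addr_ge0 ?mulr_ge0.
have z0 : 0 <= z := sqrtr_ge0 _.
have z2 : z ^+ 2 = M * s + 2 * M ^+ 2 * s * X by rewrite sqr_sqrtr//; ring.
have t2 : tau ^+ 2 <= tau ^+ 4 by rewrite ler_weXn2l.
have t1 : tau <= tau ^+ 4 by rewrite -[X in X <= _]expr1 ler_weXn2l.
have T1 : 1 <= tau ^+ 4 by rewrite exprn_ege1.
have tX : 2 * (tau * X) <= tau ^+ 4 + 2 * B * s.
  by have := sqr_ge0 (tau - X); rewrite sqrrB X2; lra.
have part1 : tau * (2 * (1 + 2 * (M * X))) <=
             (2 + 2 * M + 4 * M * B) * (tau ^+ 4 + s).
  have h1 := ler_wpM2l M0 tX.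
  have h2 : 0 <= M * s by rewrite mulr_ge0.
  have h3 : 0 <= M * B * tau ^+ 4 by rewrite !mulr_ge0// exprn_ge0.
  lra.
set c := 1 + 2 * M ^+ 2 + 16 * M ^+ 4 * B.
have MM0 : 0 <= M ^+ 2 by rewrite exprn_ge0.
have M4B : 0 <= M ^+ 4 * B by rewrite mulr_ge0// exprn_ge0.
have c1 : 1 <= c by rewrite /c; lra.
have c0 : 0 <= c by lra.
(* taking fourth powers avoids the nested roots *)
have part2 : tau * z <= c * (tau ^+ 4 + s).
  have cs0 : 0 <= c * (tau ^+ 4 + s) by rewrite mulr_ge0//; lra.
  rewrite -(@ler_pXn2r _ 4) ?nnegrE ?(mulr_ge0 tau0 z0)//.
  have z4 : z ^+ 4 = (z ^+ 2) ^+ 2 by rewrite -exprM.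
  rewrite !exprMn z4 z2.
  move: (tau ^+ 4) T1 => T T1; have T0 : 0 <= T by lra.
  have Ts0 : 0 <= T + s by lra.
  apply: (@le_trans _ _ (c * (T + s) ^+ 4)); last first.
    by rewrite ler_wpM2r ?exprn_ge0// -[leLHS]expr1 ler_weXn2l.
  have sqb (a b : R) : (a + b) ^+ 2 <= 2 * a ^+ 2 + 2 * b ^+ 2.
    by have := sqr_ge0 (a - b); rewrite sqrrB sqrrD; lra.
  apply: (@le_trans _ _ (T * (2 * (M * s) ^+ 2 + 2 * (2 * M ^+ 2 * s * X) ^+ 2))).
    by rewrite ler_wpM2l.
  rewrite [(2 * M ^+ 2 * s * X) ^+ 2]exprMn X2.
  have -> : T * (2 * (M * s) ^+ 2 + 2 * ((2 * M ^+ 2 * s) ^+ 2 * (2 * B * s))) =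
     2 * M ^+ 2 * (T * s ^+ 2) + 16 * (M ^+ 4 * B) * (T * s ^+ 3) by ring.
  have Ts3 : T * s ^+ 3 <= (T + s) ^+ 4.
    by rewrite [leRHS]exprS ler_pM ?exprn_ge0 ?lerDl// ler_pXn2r ?nnegrE// lerDr.
  have Ts2 : T * s ^+ 2 <= (T + s) ^+ 4.
    apply: (@le_trans _ _ (T ^+ 2 * s ^+ 2)).
      by rewrite ler_wpM2r ?exprn_ge0// -[leLHS]expr1 ler_weXn2l.
    have -> : (T + s) ^+ 4 = (T + s) ^+ 2 * (T + s) ^+ 2 by rewrite -exprD.
    rewrite ler_pM ?exprn_ge0// ler_pXn2r ?nnegrE//.
      by rewrite lerDl.
    by rewrite lerDr.
  have P4 : 0 <= (T + s) ^+ 4 by rewrite exprn_ge0.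
  have h1 := ler_wpM2l MM0 Ts2; have h2 := ler_wpM2l M4B Ts3.
  rewrite /c; lra.
rewrite /regret_const -/c; lra.
Qed.

Lemma ln_le_powR (eta : R) (T : nat) : 0 < eta -> (0 < T)%N ->
  1 + 2 * ln T%:R <= (1 + 2 / eta) * T%:R `^ eta.
Proof.
move=> eta0 T0; have T1 : 1 <= T%:R :> R by rewrite ler1n.
have Tpos : 0 < T%:R :> R by rewrite ltr0n.
have p1 : 1 <= T%:R `^ eta by rewrite -[leLHS](powRr0 T%:R) ler_powR// ltW.
have : ln (T%:R `^ eta) <= T%:R `^ eta - 1.
  have E : T%:R `^ eta = 1 + (T%:R `^ eta - 1) by ring.
  by rewrite [X in ln X]E le_ln1Dx//; lra.
rewrite ln_powR => h.
have : ln T%:R <= T%:R `^ eta / eta by rewrite ler_pdivlMr// mulrC; lra.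
lra.
Qed.

(** The path length gives T ^ (1/4 - theta / 2) with theta = min delta (1/2), the
    minimum making this dominate the diameter as well. Half of the gain theta / 2
    is spent on the logarithm, which leaves theta / 4. *)
Definition rate_exponent (delta : R) : R := Num.min delta 2^-1 / 4.

Lemma rate_exponent_gt0 delta : 0 < delta -> 0 < rate_exponent delta.
Proof. by move=> d0; rewrite divr_gt0// lt_min d0 invr_gt0 ltr0n. Qed.

Lemma powR_natN_cvg0 (eta : R) : 0 < eta ->
  (fun T : nat => T%:R `^ (- eta)) @ \oo --> (0 : R).
Proof.
move=> eta0; apply/cvgrPdist_le => e e0.
near=> T.
have T0 : 0 < T%:R :> R by near: T; exact: nbhs_infty_gtr.
rewrite sub0r normrN ger0_norm ?powR_ge0// powRN.
have eT : e^-1 `^ (eta^-1) <= T%:R by near: T; exact: nbhs_infty_ger.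
rewrite -[e]invrK lef_pV2 ?posrE ?powR_gt0 ?invr_gt0//.
have -> : e^-1 = (e^-1 `^ (eta^-1)) `^ eta.
  by rewrite -powRrM mulVf ?gt_eqF// powRr1// invr_ge0 ltW.
by rewrite ge0_ler_powR ?nnegrE ?powR_ge0// ltW.
Unshelve. all: by end_near. Qed.

Definition rate_const (K0 Ca delta : R) : R :=
  `|K0| * (Num.sqrt (2 * (2 + `|Ca|)) * (1 + 2 / rate_exponent delta)).

Lemma rate_const_ge0 K0 Ca delta : 0 < delta -> 0 <= rate_const K0 Ca delta.
Proof.
move=> d0; rewrite !mulr_ge0 ?sqrtr_ge0// addr_ge0// divr_ge0//.
exact/ltW/rate_exponent_gt0.
Qed.

Lemma regret_rate (K0 Ca delta D p : R) (T : nat) : 0 < delta -> (0 < T)%N ->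
  0 <= D <= 2 -> 0 <= p <= Ca * T%:R `^ (2^-1 - delta) ->
  `|K0| * (Num.sqrt (D * (D + p)) * (1 + 2 * ln T%:R)) <=
  rate_const K0 Ca delta * T%:R `^ (- rate_exponent delta) * T%:R `^ 4^-1.
Proof.
move=> d0 T0 /andP[D0 D2] /andP[p0 pC].
have eta0 := rate_exponent_gt0 d0.
set eta := rate_exponent delta in eta0 *.
have theta : 4 * eta <= delta /\ 4 * eta <= 2^-1.
  rewrite /eta /rate_exponent mulrC divfK//.
  by rewrite !ge_min !lexx orbT.
have T1 : 1 <= T%:R :> R by rewrite ler1n.
have Tpos : 0 < T%:R :> R by rewrite ltr0n.
set b := T%:R `^ (2^-1 - 4 * eta).
have b1 : 1 <= b.
  rewrite -(powRr0 T%:R) ler_powR//; lra.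
have pb : p <= `|Ca| * b.
  rewrite (le_trans pC)// (le_trans (y := `|Ca| * T%:R `^ (2^-1 - delta)))//.
    by rewrite ler_wpM2r ?powR_ge0// ler_norm.
  by rewrite ler_wpM2l// ler_powR//; lra.
rewrite /rate_const -!mulrA ler_wpM2l//.
have -> : T%:R `^ (- eta) * T%:R `^ 4^-1 =
   T%:R `^ (4^-1 - 2 * eta) * T%:R `^ eta.
  have Tn0 : T%:R != 0 :> R by rewrite gt_eqF.
  by rewrite -!powRD ?Tn0 ?implybT//; congr (_ `^ _); lra.
have sqb : Num.sqrt (D * (D + p)) <=
    Num.sqrt (2 * (2 + `|Ca|)) * T%:R `^ (4^-1 - 2 * eta).
  have -> : T%:R `^ (4^-1 - 2 * eta) = Num.sqrt b.
    rewrite -powR12_sqrt ?powR_ge0// /b -powRrM; congr (_ `^ _); lra.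
  rewrite -sqrtrM ?mulr_ge0 ?addr_ge0// ler_wsqrtr//.
  rewrite -mulrA ler_pM ?addr_ge0//.
  by rewrite mulrDl lerD//; lra.
apply: le_trans (_ : Num.sqrt (2 * (2 + `|Ca|)) * T%:R `^ (4^-1 - 2 * eta) *
    ((1 + 2 / eta) * T%:R `^ eta) <= _); last first.
  by rewrite le_eqVlt; apply/orP; left; apply/eqP; ring.
rewrite ler_pM ?sqrtr_ge0//; last exact: ln_le_powR.
by rewrite addr_ge0// mulr_ge0// ln_nat_ge0.
Qed.

End Rates.

(** * Drift under NSO *)

Section NSO.
Context {R : realType} {S : finType}.
Variables (L : {set S * S}) (M Rlam CW epsW Ca delta K0 : R) (T : nat).
Variables (pfol : olo_alg R S).
Variables (C lam : nat -> S -> S -> R) (aref x : nat -> S -> S -> S -> R).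
Hypotheses (M0 : 0 <= M) (Rlam0 : 0 <= Rlam) (epsW0 : 0 <= epsW).
Hypothesis delta0 : 0 < delta.
Hypothesis T0 : (0 < T)%N.
Hypothesis PFOL : PFOL_guarantee (simplex R S) K0 pfol.
Hypothesis CP : forall t n m, (1 <= t <= T)%N -> (n, m) \in L -> 0 <= C t n m <= M.
Hypothesis lamP : forall t n k, (1 <= t <= T)%N -> 0 <= lam t n k <= Rlam.
Hypothesis arefP : forall t n m, (1 <= t <= T)%N -> (n, m) \in L ->
  simplex R S (aref t n m).
Hypothesis stable : piecewise_stable L T CW epsW C lam aref.
Hypothesis pathP : forall t, (1 <= t <= T)%N ->
  path_length L aref t <= Ca * t%:R `^ (2^-1 - delta).
Hypothesis xP : forall t n m k, (1 <= t <= T)%N -> (n, m) \in L ->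
  0 <= x t n m k <= M.

Let N : R := #|S|%:R.
Let incr : R := N * M + Rlam.
Let Q := queue L lam x.
Let a := nso_action L pfol M C lam x.
Let q := queue_norm1 L lam x.
Let total : R := \sum_(1 <= t < T.+1) q t.
Let diff t n m : S -> R := Q t m \- Q t n.

(** The difference between the jobs sent and their conditional expectations,
    weighted by the differences of queue lengths that price them. *)
Definition nso_noise : R :=
  \sum_(1 <= t < T.+1) \sum_(l in L) \sum_k
    (x t l.1 l.2 k - C t l.1 l.2 * a t l.1 l.2 k) * (Q t l.1 k - Q t l.2 k).

Lemma total_ge0 : 0 <= total.
Proof. by apply: sumr_ge0 => t _; exact: queue_norm1_ge0. Qed.

Lemma queue_le_norm1 t n k : (t <= T.+1)%N -> 0 <= Q t n k <= q t.
Proof.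
move=> tT; rewrite (queue_ge0 M0 lamP xP)//=.
rewrite /q /queue_norm1 (bigD1 n)//= (bigD1 k)//= -addrA.
apply: (le_trans (ler_norm _)); rewrite lerDl addr_ge0// sumr_ge0// => i _.
by rewrite sumr_ge0.
Qed.

Lemma normoo_diff t n m : (1 <= t <= T)%N -> normoo (diff t n m) <= q t.
Proof.
move=> /andP[_ tT]; apply: normoo_le; first exact: queue_norm1_ge0.
move=> k; have tT' : (t <= T.+1)%N by rewrite ltnW.
have /andP[n0 nq] := queue_le_norm1 n k tT'.
have /andP[m0 mq] := queue_le_norm1 m k tT'.
by rewrite /diff/= ler_norml; apply/andP; split; lra.
Qed.

Let B : R := N ^+ 2 * incr.
Let X : R := Num.sqrt (2 * B * total).

(** The losses are differences of queues, hence bounded by their total length q.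
    Their maximum and their sum, the two quantities in the regret of AdaPFOL, are
    of order sqrt total and total. *)
Lemma link_regret l : l \in L ->
  \sum_(1 <= t < T.+1)
    inner (fun k => C t l.1 l.2 * diff t l.1 l.2 k)
          (a t l.1 l.2 \- aref t l.1 l.2) <=
  rate_const K0 Ca delta * regret_const M B *
    T%:R `^ (- rate_exponent delta) * (T%:R + total).
Proof.
case: l => n m lL /=.
have B0 : 0 <= B by rewrite mulr_ge0 ?sqr_ge0// incr_ge0.
set g := fun t k => C t n m * diff t n m k.
pose G t := M * normoo (diff t n m).
have gG t : (1 <= t <= T)%N -> normoo (g t) <= G t.
  move=> tT; have /andP[C0 CM] := CP tT lL.
  by rewrite (le_trans (normooZ _ C0))// ler_wpM2r// normoo_ge0.
have GX t : (1 <= t <= T)%N -> G t <= M * X.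
  move=> tT; rewrite ler_wpM2l// (le_trans (normoo_diff _ _ tT))//.
  exact: queue_norm1_sup M0 Rlam0 lamP xP _ tT.
have MX0 : 0 <= M * X by rewrite mulr_ge0 ?sqrtr_ge0.
have := adapfol_regret PFOL gG (fun t tT => arefP tT lL) GX MX0.
move=> /le_trans; apply.
have lossM : total_loss T g <= M * total.
  rewrite mulr_sumr; apply: ler_sum_nat => t tT.
  by rewrite (le_trans (gG t tT))// ler_wpM2l// normoo_diff.
have tau1 : 1 <= T%:R `^ 4^-1 :> R.
  by rewrite -[leLHS](powRr0 T%:R) ler_powR ?ler1n ?invr_ge0.
have tau4 : (T%:R `^ 4^-1) ^+ 4 = T%:R :> R.
  by rewrite -powR_mulrn ?powR_ge0// -powRrM mulVf// powRr1.
have X2 : X ^+ 2 = 2 * B * total.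
  by rewrite sqr_sqrtr// mulr_ge0 ?total_ge0// mulr_ge0.
have fr := fourth_root_bound M0 B0 tau1 total_ge0 (sqrtr_ge0 _) X2.
rewrite tau4 in fr.
have scale : regret_scale (simplex R S) K0 T (fun t => aref t n m) <=
   rate_const K0 Ca delta * T%:R `^ (- rate_exponent delta) * T%:R `^ 4^-1.
  apply: regret_rate => //.
    by rewrite diameter1_ge0 diameter1_simplex.
  rewrite sumr_ge0 => [|t _]; last exact: norm1_ge0.
  rewrite (le_trans _ (pathP _)) ?T0 ?leqnn//.
  apply: ler_sum_nat => t _; rewrite (bigD1 (n, m))//= lerDl.
  by apply: sumr_ge0 => l _; exact: norm1_ge0.
set Z := 2 * (1 + _) + _.
have Z0 : 0 <= Z by rewrite /Z addr_ge0// mulr_ge0 ?sqrtr_ge0// addr_ge0// mulr_ge0.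
apply: (le_trans (ler_wpM2r Z0 scale)).
have main : T%:R `^ 4^-1 * Z <= regret_const M B * (T%:R + total).
  apply: le_trans fr; rewrite ler_wpM2l ?powR_ge0// lerD2l ler_wpM2l//.
  by rewrite ler_wsqrtr// ler_wpM2l// addr_ge0// mulr_ge0.
have r0 : 0 <= rate_const K0 Ca delta * T%:R `^ (- rate_exponent delta).
  by rewrite mulr_ge0 ?rate_const_ge0 ?powR_ge0.
rewrite -[leLHS]mulrA (le_trans (ler_wpM2l r0 main))//.
by rewrite le_eqVlt; apply/orP; left; apply/eqP; ring.
Qed.

Definition regret_fraction : R :=
  #|L|%:R * (rate_const K0 Ca delta * regret_const M B *
    T%:R `^ (- rate_exponent delta)).

(** The weighted net service of the flow that is sent equals that of the reference
    flow, plus the noise, minus the regret; the drift bounds the first from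
    above and stability bounds the second from below. *)
Lemma nso_drift :
  epsW * total + nso_noise <=
    (2 * (N ^+ 2 * (incr ^+ 2 + epsW * incr)) * CW +
     N ^+ 2 * ((N * M) ^+ 2 + incr ^+ 2) / 2) * T%:R +
    regret_fraction * (T%:R + total).
Proof.
have drift := lyapunov_drift M0 Rlam0 lamP xP.
have surplus := reference_surplus M0 Rlam0 lamP xP epsW0 CP arefP stable.
set f := fun (t : nat) n m k => C t n m * aref t n m k in surplus.
set reg := \sum_(l in L) \sum_(1 <= t < T.+1)
    inner (fun k => C t l.1 l.2 * diff t l.1 l.2 k)
          (a t l.1 l.2 \- aref t l.1 l.2).
have regP : reg <= regret_fraction * (T%:R + total).
  rewrite /regret_fraction -mulrA mulr_natl -sumr_const.
  by apply: ler_sum => l lL; exact: link_regret.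
have split : \sum_(1 <= t < T.+1) queue_dot L lam x x t -
    \sum_(1 <= t < T.+1) queue_dot L lam x f t = nso_noise - reg.
  have -> : reg = \sum_(1 <= t < T.+1) \sum_(l in L)
      inner (fun k => C t l.1 l.2 * diff t l.1 l.2 k)
            (a t l.1 l.2 \- aref t l.1 l.2) by exact: exchange_big.
  rewrite /nso_noise -!sumrB; apply: eq_bigr => t _.
  rewrite queue_dotB -sumrB; apply: eq_bigr => l _.
  rewrite /inner -sumrB; apply: eq_bigr => k _.
  by rewrite /f /diff/= -/Q; ring.
move: drift surplus; rewrite -/N -/incr -/total; lra.
Qed.

End NSO.

(** * Conditional expectation *)

Section BoundedIntegrals.
Context d (Omega : measurableType d) {R : realType} (P : probability Omega R).
Implicit Types f g : Omega -> R.

Lemma integrable_bounded f (c : R) : measurable_fun setT f ->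
  (forall w, `|f w| <= c) -> P.-integrable setT (EFin \o f).
Proof.
move=> mf fc; apply: measurable_bounded_integrable => //.
  exact: fin_num_fun_lty.
exists c; split; first exact: num_real.
by move=> b cb w _ /=; rewrite (le_trans (fc w))// ltW.
Qed.

Definition zero_mean f : Prop :=
  P.-integrable setT (EFin \o f) /\ \int[P]_w f w = 0.

Lemma zero_mean0 : zero_mean (fun=> 0).
Proof.
split; first by apply: (@integrable_bounded _ 0) => // w; rewrite normr0.
by rewrite Rintegral_cst// mul0r.
Qed.

Lemma zero_meanD f g : zero_mean f -> zero_mean g ->
  zero_mean (fun w => f w + g w).
Proof.
move=> [fi f0] [gi g0]; split; first by apply: (integrableD _ fi gi).
by rewrite RintegralD// f0 g0 addr0.
Qed.

Lemma zero_meanB f g : zero_mean f -> zero_mean g ->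
  zero_mean (fun w => f w - g w).
Proof.
move=> [fi f0] [gi g0]; split; first by apply: (integrableB _ fi gi).
by rewrite RintegralB// f0 g0 subr0.
Qed.

Lemma zero_mean_sum (I : Type) (r : seq I) (p : pred I) (F : I -> Omega -> R) :
  (forall i, p i -> zero_mean (F i)) ->
  zero_mean (fun w => \sum_(i <- r | p i) F i w).
Proof.
move=> F0; elim: r => [|i r IH].
  by under eq_fun do rewrite big_nil; exact: zero_mean0.
under eq_fun do rewrite big_cons.
case: (boolP (p i)) => pi //; exact: zero_meanD (F0 i pi) IH.
Qed.

End BoundedIntegrals.

Section PullOut.
Context d (Omega : measurableType d) {R : realType} (P : probability Omega R).
Variable H : set_system Omega.
Hypothesis Hm : H `<=` measurable.

Lemma g_sigma_measurable E : <<s H >> E -> measurable E.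
Proof. by apply: smallest_sub => //; exact: sigma_algebra_measurable. Qed.

Lemma g_sigma_measurable_fun (f : Omega -> R) :
  measurable_fun [set: g_sigma_algebraType H] (f : g_sigma_algebraType H -> R) ->
  measurable_fun [set: Omega] f.
Proof.
move=> mf _ B mB; apply: g_sigma_measurable.
exact: mf measurableT B mB.
Qed.

(** If D integrates to 0 over every event of a sub-sigma-algebra, then D * Z has
    mean zero for bounded Z measurable with respect to it. The proof halves the
    range of Z: subtracting c / 2 on the event c / 2 <= Z changes the mean of
    D * Z by a multiple of the integral of D over that event, that is by 0, and
    leaves a function with values in [0, c / 2]. *)
Lemma zero_mean_mul (D : Omega -> R) (M : R) : 0 <= M ->
  measurable_fun setT D -> (forall w, `|D w| <= M) ->
  (forall E, <<s H >> E -> \int[P]_(w in E) D w = 0) ->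
  forall (c : R) (Z : Omega -> R), 0 <= c ->
    measurable_fun [set: g_sigma_algebraType H] (Z : g_sigma_algebraType H -> R) ->
    (forall w, 0 <= Z w <= c) -> zero_mean P (fun w => D w * Z w).
Proof.
move=> M0 mD DM D0.
have DZi (c : R) (Z : Omega -> R) :
    measurable_fun [set: g_sigma_algebraType H] (Z : g_sigma_algebraType H -> R) ->
    (forall w, 0 <= Z w <= c) -> P.-integrable setT (EFin \o (fun w => D w * Z w)).
  move=> mZ Zc; apply: (@integrable_bounded _ _ _ _ _ (M * c)).
    by apply: measurable_funM => //; exact: g_sigma_measurable_fun.
  move=> w; have /andP[Z0 Zw] := Zc w; rewrite normrM ler_pM//.
  by rewrite ger0_norm.
have halving n : forall (c : R) (Z : Omega -> R), 0 <= c ->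
    measurable_fun [set: g_sigma_algebraType H] (Z : g_sigma_algebraType H -> R) ->
    (forall w, 0 <= Z w <= c) ->
    `|\int[P]_w (D w * Z w)| <= M * c / 2 ^+ n.
  elim: n => [|n IH] c Z c0 mZ Zc.
    have int1 := DZi c Z mZ Zc.
    rewrite expr0 divr1 (le_trans (le_normr_Rintegral _ int1))//.
    have -> : M * c = \int[P]_(w in setT) (M * c).
      by rewrite Rintegral_cst// (_ : fine (P setT) = 1) ?mulr1 ?probability_setT.
    apply: le_Rintegral => //.
    - exact: (integrable_norm int1).
    - apply: (@integrable_bounded _ _ _ _ _ (M * c)) => // w.
      by rewrite ger0_norm// mulr_ge0.
    - move=> w _; have /andP[Z0 Zw] := Zc w; rewrite normrM ler_pM//.
      by rewrite ger0_norm.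
  pose E := [set w | c / 2 <= Z w].
  pose Z' := fun w => Z w - c / 2 * \1_E w.
  have sE : <<s H >> E.
    have := mZ measurableT _ (measurable_itv `[c / 2, +oo[).
    rewrite setTI; congr (<<s H >> _).
    by apply/seteqP; split => w /=; rewrite in_itv/= andbT.
  have mZ' : measurable_fun [set: g_sigma_algebraType H]
      (Z' : g_sigma_algebraType H -> R).
    apply: measurable_funB => //; apply: measurable_funM => //.
  have Z'c w : 0 <= Z' w <= c / 2.
    have /andP[Z0 Zw] := Zc w; rewrite /Z' indicE.
    case: (boolP (w \in E)) => [/set_mem|/negP].
      by rewrite /E/= mulr1 => h; apply/andP; split; lra.
    move=> wE; have {}wE : Z w < c / 2.
      by rewrite ltNge; apply/negP => h; apply: wE; exact: mem_set.
    by rewrite mulr0 subr0 Z0 ltW.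
  have c20 : 0 <= c / 2 by rewrite divr_ge0.
  have -> : \int[P]_w (D w * Z w) = \int[P]_w (D w * Z' w).
    have mE := g_sigma_measurable sE.
    have indDi : P.-integrable setT (EFin \o (fun w => D w * \1_E w)).
      apply: (@integrable_bounded _ _ _ _ _ M).
        by apply: measurable_funM => //; exact: measurable_indic.
      move=> w; rewrite normrM -[leRHS]mulr1 ler_pM//.
      by rewrite indicE; case: (_ \in _); rewrite ?normr1 ?normr0.
    have indD0 : \int[P]_w (D w * \1_E w) = 0.
      rewrite -[RHS](D0 E sE) [RHS]Rintegral_mkcond; apply: eq_Rintegral => w _.
      by rewrite patchE indicE; case: (_ \in _); rewrite ?mulr1 ?mulr0.
    have -> : (fun w => D w * Z' w) =
        (fun w => D w * Z w - c / 2 * (D w * \1_E w)).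
      by apply/funext => w; rewrite /Z'; ring.
    rewrite RintegralB//; last 2 first.
    - exact: DZi mZ Zc.
    - exact: (@integrableZl _ _ _ P setT measurableT (c / 2) _ indDi).
    by rewrite RintegralZl// indD0 mulr0 subr0.
  have := IH _ Z' c20 mZ' Z'c.
  by rewrite exprS invfM !mulrA.
move=> c Z c0 mZ Zc; split; first exact: DZi mZ Zc.
apply/eqP; rewrite -normr_le0; apply/ler_addgt0Pr => e e0; rewrite add0r.
have Mc0 : 0 <= M * c by rewrite mulr_ge0.
have [n nP] : exists n, M * c / e <= 2 ^+ n.
  exists (Num.truncn (M * c / e)).+1.
  apply: (le_trans (ltW (truncnS_gt _))).
  by rewrite -natrX ler_nat ltnW// ltn_expl.
apply: (le_trans (halving n c Z c0 mZ Zc)).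
by rewrite ler_pdivrMr ?exprn_gt0// -ler_pdivrMl// mulrC.
Qed.

(** Z can be taken out of the conditional expectation Y of X. *)
Lemma zero_mean_cond_exp (X Y : Omega -> R) (M : R) : 0 <= M ->
  measurable_fun setT X -> (forall w, 0 <= X w <= M) -> (forall w, 0 <= Y w <= M) ->
  is_cond_exp P H X Y ->
  forall (c : R) (Z : Omega -> R), 0 <= c ->
    measurable_fun [set: g_sigma_algebraType H] (Z : g_sigma_algebraType H -> R) ->
    (forall w, 0 <= Z w <= c) -> zero_mean P (fun w => (X w - Y w) * Z w).
Proof.
move=> M0 mX XM YM [mY iY XY]; apply: zero_mean_mul M0 _ _ _.
- by apply: measurable_funB => //; exact: g_sigma_measurable_fun.
- move=> w; have /andP[X0 XM'] := XM w; have /andP[Y0 YM'] := YM w.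
  by rewrite ler_norml; apply/andP; split; lra.
- move=> E sE; have mE := g_sigma_measurable sE.
  have iX : P.-integrable setT (EFin \o X).
    apply: (@integrable_bounded _ _ _ _ _ M) => // w.
    by have /andP[X0 ?] := XM w; rewrite ger0_norm.
  rewrite RintegralB//; try by apply: integrableS iX || apply: integrableS iY.
  by rewrite /Rintegral XY// subrr.
Qed.

End PullOut.

(** * Randomness of the network *)

Section NetworkMeasurability.
Context d (Omega : measurableType d) {R : realType} (P : probability Omega R).
Context {S : finType}.
Variables (L : {set S * S}) (mu : nat -> S -> S -> S -> {RV P >-> R}).
Variable lam : nat -> S -> S -> R.

Lemma history_measurable t : history L mu t `<=` measurable.
Proof.
move=> _ [s [n [m [k [B [_ _ mB ->]]]]]].
by rewrite -[_ @^-1` _]setTI; exact: measurable_funP.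
Qed.

Lemma measurable_transmission t s n m k : (1 <= s < t)%N -> (n, m) \in L ->
  measurable_fun [set: g_sigma_algebraType (history L mu t)]
    (mu s n m k : g_sigma_algebraType (history L mu t) -> R).
Proof.
move=> st nm _ B mB; rewrite setTI; apply: sub_sigma_algebra.
by exists s, n, m, k, B.
Qed.

(** The queues at the beginning of round t depend only on the transmissions of
    earlier rounds. *)
Lemma measurable_queue t s n k : (s <= t)%N ->
  measurable_fun [set: g_sigma_algebraType (history L mu t)]
    ((fun w => queue L lam (realization mu w) s n k) :
       g_sigma_algebraType (history L mu t) -> R).
Proof.
elim: s n k => [//|[//|s] IH] n k st.
have [->|kn] := eqVneq k n.
  under eq_fun do rewrite queue_self; exact: measurable_cst.
under eq_fun do rewrite queueS//.
have msum (p : pred S) (F : S -> Omega -> R) :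
    (forall i, p i -> measurable_fun [set: g_sigma_algebraType (history L mu t)]
       (F i : g_sigma_algebraType (history L mu t) -> R)) ->
    measurable_fun [set: g_sigma_algebraType (history L mu t)]
       ((fun w => \sum_(i | p i) F i w) : g_sigma_algebraType (history L mu t) -> R).
  move=> mF; under eq_fun do rewrite big_mkcond/=.
  apply: (@measurable_sum _ (g_sigma_algebraType (history L mu t)) R) => i.
  by case: (boolP (p i)) => [/mF//|_]; exact: measurable_cst.
apply: measurable_funD => //; apply: measurable_funD.
  apply: measurable_maxr => //; apply: measurable_funB; first exact: IH (ltnW st).
  by apply: msum => m nm; exact: measurable_transmission.
by apply: msum => o on; exact: measurable_transmission.
Qed.

End NetworkMeasurability.

Section Stability.
Context d (Omega : measurableType d) {R : realType} (P : probability Omega R).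
Context {S : finType}.
Variables (L : {set S * S}) (mu : nat -> S -> S -> S -> {RV P >-> R}).
Variables (M Rlam K0 : R) (T : nat) (pfol : olo_alg R S).
Variables (C lam : nat -> S -> S -> R).
Hypotheses (M0 : 0 <= M) (Rlam0 : 0 <= Rlam).
Hypothesis PFOL : PFOL_guarantee (simplex R S) K0 pfol.
Hypothesis CP : forall t n m, (1 <= t <= T)%N -> (n, m) \in L -> 0 <= C t n m <= M.
Hypothesis lamP : forall t n k, (1 <= t <= T)%N -> 0 <= lam t n k <= Rlam.
Hypothesis muP : nso_transmissions L mu pfol M C lam T.

Let N : R := #|S|%:R.
Let B : R := N ^+ 2 * (N * M + Rlam).
Let total w : R := \sum_(1 <= t < T.+1) queue_norm1 L lam (realization mu w) t.

Lemma realizationP w t n m k : (1 <= t <= T)%N -> (n, m) \in L ->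
  0 <= realization mu w t n m k <= M.
Proof. by move=> tT nm; have [xM _ _] := muP tT; exact: xM. Qed.

Lemma total_bounds w : 0 <= total w <= B * T%:R * T%:R.
Proof.
apply/andP; split; first by apply: sumr_ge0 => t _; exact: queue_norm1_ge0.
apply: (@le_trans _ _ (\sum_(1 <= t < T.+1) B * T%:R)).
  apply: ler_sum_nat => t /andP[t1 tT].
  have t1T : (1 <= t <= T.+1)%N by rewrite t1 ltnW.
  rewrite (le_trans (queue_norm1_lin M0 Rlam0 lamP (realizationP w) t1T))//.
  by rewrite ler_wpM2l ?ler_nat// mulr_ge0 ?sqr_ge0// incr_ge0.
by rewrite sumr_const_nat subn1 -[leLHS]mulr_natr.
Qed.

Lemma integrable_total : P.-integrable setT (EFin \o total).
Proof.
apply: (@integrable_bounded _ _ _ _ _ (B * T%:R * T%:R)); last first.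
  by move=> w; have /andP[t0 tB] := total_bounds w; rewrite ger0_norm.
apply: measurable_sum => t; apply: measurable_sum => n; apply: measurable_sum => k.
apply: measurableT_comp => //.
have mq := @measurable_queue _ _ _ _ _ L mu lam t t n k (leqnn t).
exact: (g_sigma_measurable_fun (@history_measurable _ _ _ _ _ L mu t) mq).
Qed.

(** Given the past, the transmissions have the mean assumed in the noise, and the
    queues that weight them are known. *)
Lemma zero_mean_noise :
  zero_mean P (fun w => nso_noise L M T pfol C lam (realization mu w)).
Proof.
rewrite /nso_noise.
under eq_fun do rewrite big_nat.
apply: zero_mean_sum => t tT; apply: zero_mean_sum => -[n m] nm /=.
apply: zero_mean_sum => k _.
under eq_fun do rewrite mulrBr.
have /andP[t1 tT'] := tT.
have {}tT : (1 <= t <= T)%N by rewrite t1.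
have [xM ce _] := muP tT.
have queue_bounds w n' k' : 0 <= queue L lam (realization mu w) t n' k' <= B * t%:R.
  have /andP[q0 qn] :=
    queue_le_norm1 M0 lamP (realizationP w) n' k' (ltnW (tT' : (t < T.+1)%N)).
  rewrite q0 (le_trans qn)//.
  by apply: (queue_norm1_lin M0 Rlam0 lamP (realizationP w)); rewrite t1 ltnW.
have Bt0 : 0 <= B * t%:R by rewrite mulr_ge0// mulr_ge0 ?sqr_ge0// incr_ge0.
have key n' : zero_mean P (fun w => (realization mu w t n m k -
     C t n m * nso_action L pfol M C lam (realization mu w) t n m k) *
    queue L lam (realization mu w) t n' k).
  apply: (zero_mean_cond_exp (@history_measurable _ _ _ _ _ L mu t) M0
    _ _ _ (ce n m k nm) Bt0).
  - exact: measurable_funP.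
  - by move=> w; exact: xM.
  - move=> w; have /andP[C0 CM] := CP tT nm.
    have sa : simplex R S (nso_action L pfol M C lam (realization mu w) t n m).
      exact: PFOL.1.
    have [a0 _] := sa.
    by rewrite mulr_ge0//= -[leRHS]mulr1 ler_pM// simplex_le1.
  - exact: measurable_queue.
  - by move=> w.
exact: zero_meanB (key n) (key m).
Qed.

End Stability.

(** * Stability *)

Section Conclusion.
Context {R : realType}.

(** The bound A + rho over eps - rho, linearized in rho. *)
Lemma expectation_bound_alg (eps rho A y : R) : 0 < eps -> 0 <= A -> 0 <= rho ->
  rho <= eps / 2 -> (eps - rho) * y <= A + rho ->
  y <= A / eps + 2 * (A + eps) / eps ^+ 2 * rho.
Proof.
move=> eps0 A0 rho0 rho_le ey.
have er : 0 < eps - rho by lra.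
rewrite -(ler_pM2l er) (le_trans ey)// -subr_ge0.
have -> : (eps - rho) * (A / eps + 2 * (A + eps) / eps ^+ 2 * rho) - (A + rho) =
    rho * (A + eps) * (eps - 2 * rho) / eps ^+ 2.
  by field; rewrite gt_eqF.
by rewrite divr_ge0 ?exprn_ge0 ?(ltW eps0)// !mulr_ge0//; lra.
Qed.

Definition stability_const (N M Rlam CW epsW : R) : R :=
  (N ^+ 2 * (2 * N * M + Rlam) ^+ 2 + epsW * N ^+ 2 * (2 * N * M + Rlam)) * CW
  + (N ^+ 4 * M ^+ 2 + N ^+ 2 * Rlam ^+ 2).

Lemma stability_constP (N M Rlam CW epsW : R) : 0 <= N -> 0 <= M -> 0 <= Rlam ->
  0 <= CW -> 0 <= epsW -> let B0 := N * M + Rlam in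
  2 * (N ^+ 2 * (B0 ^+ 2 + epsW * B0)) * CW + N ^+ 2 * ((N * M) ^+ 2 + B0 ^+ 2) / 2 <=
  2 * stability_const N M Rlam CW epsW.
Proof.
move=> N0 M0 Rlam0 CW0 eps0 /=; rewrite /stability_const.
have NM0 : 0 <= N * M by rewrite mulr_ge0.
set B0 := N * M + Rlam; set B1 := 2 * N * M + Rlam.
have B00 : 0 <= B0 by rewrite addr_ge0.
have B01 : B0 <= B1 by rewrite /B0 /B1 lerD2r -mulrA; lra.
have N2 : 0 <= N ^+ 2 := sqr_ge0 N.
have sq : B0 ^+ 2 <= B1 ^+ 2 by rewrite ler_pXn2r ?nnegrE// (le_trans B00).
have sq2 : B0 ^+ 2 <= 2 * (N * M) ^+ 2 + 2 * Rlam ^+ 2.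
  by have := sqr_ge0 (N * M - Rlam); rewrite /B0 sqrrB sqrrD; lra.
have h1 : N ^+ 2 * (B0 ^+ 2 + epsW * B0) * CW <=
          (N ^+ 2 * B1 ^+ 2 + epsW * N ^+ 2 * B1) * CW.
  have -> : N ^+ 2 * B1 ^+ 2 + epsW * N ^+ 2 * B1 =
    N ^+ 2 * (B1 ^+ 2 + epsW * B1) by ring.
  by rewrite ler_wpM2r// ler_wpM2l// lerD// ler_wpM2l.
have h2 : N ^+ 2 * ((N * M) ^+ 2 + B0 ^+ 2) <=
          N ^+ 2 * (3 * (N * M) ^+ 2 + 2 * Rlam ^+ 2).
  by rewrite ler_wpM2l//; lra.
have h3 : 0 <= N ^+ 4 * M ^+ 2 by rewrite mulr_ge0 ?exprn_ge0.
have h4 : 0 <= N ^+ 2 * Rlam ^+ 2 by rewrite mulr_ge0 ?exprn_ge0.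
have h5 : N ^+ 2 * (3 * (N * M) ^+ 2 + 2 * Rlam ^+ 2) =
   3 * (N ^+ 4 * M ^+ 2) + 2 * (N ^+ 2 * Rlam ^+ 2) by ring.
lra.
Qed.

Lemma stability_const_ge0 (N M Rlam CW epsW : R) : 0 <= N -> 0 <= M -> 0 <= Rlam ->
  0 <= CW -> 0 <= epsW -> 0 <= stability_const N M Rlam CW epsW.
Proof.
move=> N0 M0 Rlam0 CW0 eps0.
by rewrite /stability_const !(addr_ge0, mulr_ge0, exprn_ge0).
Qed.

Lemma scaled_cvg0 (c : R) (f : nat -> R) :
  f @ \oo --> (0 : R) -> (fun T => c * f T) @ \oo --> (0 : R).
Proof. by move=> f0; have := cvgM (cvg_cst c) f0; rewrite mulr0; apply. Qed.

Lemma regret_fraction_cvg0 (S : finType) (L : {set S * S})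
    (M Rlam Ca delta K0 : R) : 0 < delta ->
  regret_fraction L M Rlam Ca delta K0 @ \oo --> (0 : R).
Proof.
move=> d0; rewrite /regret_fraction/=.
under eq_fun do rewrite mulrA.
under eq_fun do rewrite mulrA.
exact/scaled_cvg0/powR_natN_cvg0/rate_exponent_gt0.
Qed.

Lemma regret_fraction_ge0 (S : finType) (L : {set S * S})
    (M Rlam Ca delta K0 : R) T : 0 <= M -> 0 <= Rlam -> 0 < delta ->
  0 <= regret_fraction L M Rlam Ca delta K0 T.
Proof.
move=> M0 Rlam0 d0.
apply: mulr_ge0 => //; apply: mulr_ge0; last exact: powR_ge0.
apply: mulr_ge0; first exact: rate_const_ge0.
by apply: regret_const_ge0 => //; rewrite mulr_ge0 ?sqr_ge0// incr_ge0.
Qed.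

End Conclusion.

Theorem theorem3p6 (R : realType) :
  exists K : R, 0 < K /\
  forall (S : finType) (L : {set S * S}) (M Rlam CW epsW Ca delta_a K0 : R)
         (pfol : olo_alg R S),
    0 <= M -> 0 <= Rlam -> 0 <= CW -> 0 < epsW -> 0 < delta_a ->
    PFOL_guarantee (simplex R S) K0 pfol ->
  exists (r : nat -> R) (b : R) (T0 : nat), r @ \oo --> (0 : R) /\
  forall (T : nat) (C : nat -> S -> S -> R) (lam : nat -> S -> S -> R)
         (aref : nat -> S -> S -> S -> R)
         (d : measure_display) (Omega : measurableType d)
         (P : probability Omega R) (mu : nat -> S -> S -> S -> {RV P >-> R}),
    (0 < T)%N ->
    (forall t n m, (1 <= t <= T)%N -> (n, m) \in L -> 0 <= C t n m <= M) ->
    (forall t n k, (1 <= t <= T)%N -> 0 <= lam t n k <= Rlam) ->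
    (forall t n m, (1 <= t <= T)%N -> (n, m) \in L ->
       simplex R S (aref t n m)) ->
    piecewise_stable L T CW epsW C lam aref ->
    (forall t, (1 <= t <= T)%N ->
       path_length L aref t <= Ca * t%:R `^ (2^-1 - delta_a)) ->
    nso_transmissions L mu pfol M C lam T ->
    let N : R := #|S|%:R in
    let avg := ((T%:R^-1)%:E *
      'E_P[fun w => (\sum_(1 <= t < T.+1)
                       queue_norm1 L lam (realization mu w) t)%R])%E in
    (avg <= (K * (((N ^+ 2 * (2 * N * M + Rlam) ^+ 2
                    + epsW * N ^+ 2 * (2 * N * M + Rlam)) * CW
                   + (N ^+ 4 * M ^+ 2 + N ^+ 2 * Rlam ^+ 2)) / epsW)
             + r T)%:E)%E /\
    ((T0 <= T)%N -> (avg <= b%:E)%E).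
Proof.
exists 2; split => // S L M Rlam CW epsW Ca delta_a K0 pfol M0 Rlam0 CW0 eps0 d0 PFOL.
pose N : R := #|S|%:R.
pose A := 2 * stability_const N M Rlam CW epsW.
have A0 : 0 <= A by rewrite mulr_ge0// stability_const_ge0 ?ler0n// ltW.
pose rho := regret_fraction L M Rlam Ca delta_a K0.
have rho0 T : 0 <= rho T by exact: regret_fraction_ge0.
have rho_cvg : rho @ \oo --> (0 : R) by exact: regret_fraction_cvg0.
pose B := N ^+ 2 * (N * M + Rlam).
pose k := 2 * (A + epsW) / epsW ^+ 2.
(* while rho T is too large to be absorbed, queues are bounded by their linear
   growth; this happens for finitely many T only *)
pose r T := k * rho T + (if rho T <= epsW / 2 then 0 else B * T%:R).
have r_cvg : r @ \oo --> (0 : R).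
  have kr : (fun T => k * rho T) @ \oo --> (0 : R).
    exact: scaled_cvg0.
  apply: cvg_trans kr; apply: near_eq_cvg.
  have e20 : 0 < epsW / 2 by rewrite divr_gt0.
  move/cvgrPdist_le : rho_cvg => /(_ _ e20); apply: filterS => T.
  by rewrite sub0r normrN ger0_norm// /r => ->; rewrite addr0.
have [T0 T0P] : exists T0, forall T, (T0 <= T)%N -> r T <= 1.
  have /cvgrPdist_le /(_ 1 ltr01) [T0 _ T0P] := r_cvg.
  exists T0 => T TT0; have := T0P T TT0; rewrite sub0r normrN.
  exact: le_trans (ler_norm _).
exists r, (A / epsW + 1), T0; split => // T C lam aref d Omega P mu T_gt0 CP lamP.
move=> arefP stable pathP muP N' avg.
have T_pos : 0 < T%:R :> R by rewrite ltr0n.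
pose total w := \sum_(1 <= t < T.+1) queue_norm1 L lam (realization mu w) t.
have tot_bounds w : 0 <= total w <= B * T%:R * T%:R.
  exact: total_bounds M0 Rlam0 lamP muP w.
have tot_int : P.-integrable setT (EFin \o total).
  exact: integrable_total M0 Rlam0 lamP muP.
pose y := T%:R^-1 * \int[P]_w total w.
have avgE : avg = y%:E.
  rewrite /avg unlock /y EFinM; congr (_ * _)%E.
  by rewrite /Rintegral fineK//; apply: integrable_fin_num tot_int.
have y_le : y <= A / epsW + r T.
  rewrite /r; case: ifPn => [rho_le|_]; last first.
    have yB : y <= B * T%:R.
      rewrite /y ler_pdivrMl// mulrC.
      have -> : B * T%:R * T%:R = \int[P]_(w in setT) (B * T%:R * T%:R).
        by rewrite Rintegral_cst// (_ : fine (P setT) = 1) ?mulr1 ?probability_setT.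
      apply: le_Rintegral => //.
        by apply: (@integrable_bounded _ _ _ _ _ `|B * T%:R * T%:R|).
      by move=> w _; have /andP[] := tot_bounds w.
    have k0 : 0 <= k by rewrite divr_ge0 ?exprn_ge0 ?(ltW eps0)//; lra.
    have krho0 : 0 <= k * rho T by rewrite mulr_ge0.
    have Ae0 : 0 <= A / epsW by rewrite divr_ge0// ltW.
    lra.
  rewrite addr0; apply: expectation_bound_alg => //.
  pose noise w := nso_noise L M T pfol C lam (realization mu w).
  have [noise_int noise0] : zero_mean P noise.
    exact: zero_mean_noise M0 Rlam0 PFOL CP lamP muP.
  have drift w : (epsW - rho T) * total w + noise w <= (A + rho T) * T%:R.
    have := nso_drift M0 Rlam0 (ltW eps0) d0 T_gt0 PFOL CP lamP arefP stable pathP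
      (realizationP muP w).
    rewrite -/(total w) -/(noise w) -/(rho T) -/N.
    have := stability_constP (ler0n R #|S|) M0 Rlam0 CW0 (ltW eps0).
    rewrite /= -/N -/A => cA.
    have := ler_wpM2r (ltW T_pos) cA.
    lra.
  have scaled_int : P.-integrable setT
      (EFin \o (fun w => (epsW - rho T) * total w)).
    exact: (@integrableZl _ _ _ P setT measurableT _ _ tot_int).
  have : \int[P]_w ((epsW - rho T) * total w + noise w) <= (A + rho T) * T%:R.
    have -> : (A + rho T) * T%:R = \int[P]_(w in setT) ((A + rho T) * T%:R).
      by rewrite Rintegral_cst// (_ : fine (P setT) = 1) ?mulr1 ?probability_setT.
    apply: le_Rintegral => //.
    - exact: (integrableD _ scaled_int noise_int).
    - by apply: (@integrable_bounded _ _ _ _ _ `|(A + rho T) * T%:R|).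
  rewrite RintegralD// noise0 addr0 RintegralZl// /y => h.
  by rewrite mulrCA ler_pdivrMl// [leRHS]mulrC.
have goalE : 2 * (stability_const N M Rlam CW epsW / epsW) = A / epsW.
  by rewrite /A mulrA.
split.
  by rewrite avgE lee_fin -/N' -/(stability_const N M Rlam CW epsW) goalE.
move=> TT0; rewrite avgE lee_fin (le_trans y_le)// lerD2l.
exact: T0P.
Qed.
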